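(* Let $M$ be a finitely presented special monoid, i.e. $M$ is the monoid defined by a finite monoid presentation $\langle A\mid w_1=1,\ldots,w_k=1\rangle$, and let $G$ be the group of units of $M$. Then: (1) If $G$ is of type $\mathrm{FP}_n$ with $1\leq n\leq \infty$, then $M$ is of type left-$\mathrm{FP}_n$ and of type right-$\mathrm{FP}_n$. (2) $\mathrm{cd}\, G\leq \mathrm{left\ cd}\, M \leq \max\{2,\mathrm{cd}\, G\}$ and $\mathrm{cd}\, G\leq \mathrm{right\ cd}\, M\leq \max\{2,\mathrm{cd}\, G\}$.
   Context: A monoid $M$ is of type left-$\mathrm{FP}_n$ ($0\le n\le\infty$) if the trivial left $\mathbb ZM$-module $\mathbb Z$ (every $m\in M$ acts as the identity) has a projective resolution $(P_i)_{i\ge 0}$ with $P_i$ finitely generated for all $i\leq n$ (for all $i$ if $n=\infty$). The left cohomological dimension $\mathrm{left\ cd}\,M$ is the shortest length of a projective resolution of the trivial left $\mathbb ZM$-module $\mathbb Z$ ($\infty$ if there is no resolution of finite length). Type right-$\mathrm{FP}_n$ and $\mathrm{right\ cd}\,M$ are defined dually, using right modules (equivalently, the opposite monoid $M^{op}$). For a group $G$ these are the usual notions of type $\mathrm{FP}_n$ and cohomological dimension $\mathrm{cd}\,G$ over $\mathbb Z$. The group of units of $M$ is the group of two-sided invertible elements. *)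

(* Defs.v *)
From HB Require Import structures.
From mathcomp Require Import all_boot all_order all_algebra.
From mathcomp Require Import generic_quotient finmap monalg boolp.

Set Implicit Arguments.
Unset Strict Implicit.
Unset Printing Implicit Defensive.

Import GRing.Theory.

Local Open Scope quotient_scope.
Local Open Scope ring_scope.

Variant enat := Fin of nat | Infty.

Coercion Fin : nat >-> enat.

Definition enat_le (m n : enat) : bool :=
  match m, n with
  | _, Infty => true
  | Infty, Fin _ => false
  | Fin a, Fin b => (a <= b)%N
  end.

Definition enat_max (m n : enat) : enat :=
  match m, n with
  | Fin a, Fin b => maxn a b
  | _, _ => Infty
  end.

Definition enat_least (P : nat -> Prop) : enat :=
  match pselect (exists n, `[< P n >]) with
  | left exP => Fin (ex_minn exP)
  | right _ => Infty
  end.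

Section Units.
Variable M : monoidType.

Definition unit_pred (p : M * M) : bool :=
  (p.1 * p.2 == 1)%g && (p.2 * p.1 == 1)%g.

(* A unit is stored with its (unique) inverse, which makes inversion
   computable on an arbitrary monoid. *)
Record units := Units { unit_pair : M * M; _ : unit_pred unit_pair }.

HB.instance Definition _ := [isSub for unit_pair].
HB.instance Definition _ := [Choice of units by <:].

Definition unit_val (u : units) : M := (unit_pair u).1.

Lemma unit_pairP u : unit_pred (unit_pair u).
Proof. exact: valP u. Qed.

Lemma units_one_subproof : unit_pred (1%g, 1%g).
Proof. by rewrite /unit_pred /= mulg1 eqxx. Qed.

Lemma units_mul_subproof (u v : units) :
  unit_pred (((unit_pair u).1 * (unit_pair v).1)%g,
             ((unit_pair v).2 * (unit_pair u).2)%g).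
Proof.
case: u v => -[x x'] /andP[/= /eqP xx' /eqP x'x].
case=> -[y y'] /andP[/= /eqP yy' /eqP y'y].
rewrite /unit_pred /= -!mulgA (mulgA y) yy' mul1g xx' eqxx.
by rewrite (mulgA x') x'x mul1g y'y eqxx.
Qed.

Lemma units_inv_subproof (u : units) :
  unit_pred ((unit_pair u).2, (unit_pair u).1).
Proof. by case: u => -[x x']; rewrite /unit_pred /= andbC. Qed.

Definition units_one := Units units_one_subproof.
Definition units_mul u v := Units (units_mul_subproof u v).
Definition units_inv u := Units (units_inv_subproof u).

Lemma units_mulA : associative units_mul.
Proof. by move=> u v w; apply: val_inj; rewrite /= !mulgA. Qed.

Lemma units_mul1 : left_id units_one units_mul.
Proof. by case=> -[x x'] p; apply: val_inj; rewrite /= mul1g mulg1. Qed.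

Lemma units_1mul : right_id units_one units_mul.
Proof. by case=> -[x x'] p; apply: val_inj; rewrite /= mul1g mulg1. Qed.

Lemma units_mulV : left_inverse units_one units_inv units_mul.
Proof.
by case=> -[x x'] /[dup] /andP[/= _ /eqP p] q; apply: val_inj; rewrite /= p.
Qed.

Lemma units_Vmul : right_inverse units_one units_inv units_mul.
Proof.
by case=> -[x x'] /[dup] /andP[/= /eqP p _] q; apply: val_inj; rewrite /= p.
Qed.

HB.instance Definition _ := isGroup.Build units
  units_mulA units_mul1 units_1mul units_mulV units_Vmul.

Lemma unit_val_inj : injective unit_val.
Proof.
case=> -[x x'] p [[y y'] q] /=; rewrite /unit_val /= => xy; subst y.
apply: val_inj => /=; congr (_, _).
move/andP: p => [_ /eqP /= x'x]; move/andP: q => [/eqP /= xy' _].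
by rewrite -[x']mulg1 -xy' mulgA x'x mul1g.
Qed.

Lemma unit_val_codom (x : M) :
  (exists u, unit_val u = x) <-> (exists y, x * y = 1 /\ y * x = 1)%g.
Proof.
split=> [[u <-]|[y [xy yx]]].
  by exists (unit_pair u).2; case/andP: (unit_pairP u) => /eqP ? /eqP.
have p : unit_pred (x, y) by rewrite /unit_pred /= xy yx eqxx.
by exists (Units p).
Qed.

End Units.

Section Presentation.
Variables (A : finType) (R : seq (seq A * seq A)).

Inductive pres_congr : seq A -> seq A -> Prop :=
| pres_congr_step u v l r :
    (l, r) \in R -> pres_congr (u ++ l ++ v) (u ++ r ++ v)
| pres_congr_refl u : pres_congr u u
| pres_congr_sym u v : pres_congr u v -> pres_congr v u
| pres_congr_trans v u w :
    pres_congr u v -> pres_congr v w -> pres_congr u w.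

Definition pres_equiv (u v : seq A) : bool := `[< pres_congr u v >].

Lemma pres_equiv_refl : reflexive pres_equiv.
Proof. by move=> u; apply/asboolP; apply: pres_congr_refl. Qed.

Lemma pres_equiv_sym : symmetric pres_equiv.
Proof. by move=> u v; apply/asboolP/asboolP => /pres_congr_sym. Qed.

Lemma pres_equiv_trans : transitive pres_equiv.
Proof.
move=> v u w /asboolP uv /asboolP vw; apply/asboolP.
exact: pres_congr_trans uv vw.
Qed.

Canonical pres_equiv_rel :=
  EquivRel pres_equiv pres_equiv_refl pres_equiv_sym pres_equiv_trans.

Definition presented_monoid := {eq_quot pres_equiv_rel}.

HB.instance Definition _ := Choice.on presented_monoid.
HB.instance Definition _ := EqQuotient.on presented_monoid.

Lemma pres_congr_catl w u v : pres_congr u v -> pres_congr (w ++ u) (w ++ v).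
Proof.
elim=> {u v} [u v l r lr|u|u v _|v u x _ uv _ vx].
- by rewrite !(catA w); apply: pres_congr_step.
- exact: pres_congr_refl.
- exact: pres_congr_sym.
- exact: pres_congr_trans uv vx.
Qed.

Lemma pres_congr_catr w u v : pres_congr u v -> pres_congr (u ++ w) (v ++ w).
Proof.
elim=> {u v} [u v l r lr|u|u v _|v u x _ uv _ vx].
- by rewrite -!catA; apply: pres_congr_step.
- exact: pres_congr_refl.
- exact: pres_congr_sym.
- exact: pres_congr_trans uv vx.
Qed.

Lemma pi_presP u v :
  reflect (pres_congr u v) (\pi_presented_monoid u == \pi_presented_monoid v).
Proof. by rewrite eqmodE; apply: asboolP. Qed.

Definition pres_one : presented_monoid := \pi_presented_monoid [::].
Definition pres_mul (x y : presented_monoid) : presented_monoid :=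
  \pi_presented_monoid (repr x ++ repr y).

Lemma pres_mulE u v :
  pres_mul (\pi_presented_monoid u) (\pi_presented_monoid v) =
  \pi_presented_monoid (u ++ v).
Proof.
apply/eqP/pi_presP/(@pres_congr_trans (u ++ repr (\pi_presented_monoid v))).
  by apply: pres_congr_catr; apply/pi_presP; rewrite reprK.
by apply: pres_congr_catl; apply/pi_presP; rewrite reprK.
Qed.

Lemma pres_mulA : associative pres_mul.
Proof.
elim/quotW=> u; elim/quotW=> v; elim/quotW=> w.
by rewrite (pres_mulE v w) (pres_mulE u (v ++ w)) (pres_mulE u v)
  (pres_mulE (u ++ v) w) catA.
Qed.

Lemma pres_mul1 : left_id pres_one pres_mul.
Proof. by elim/quotW=> u; rewrite /pres_one pres_mulE. Qed.

Lemma pres_1mul : right_id pres_one pres_mul.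
Proof. by elim/quotW=> u; rewrite /pres_one pres_mulE cats0. Qed.

HB.instance Definition _ := isMonoid.Build presented_monoid
  pres_mulA pres_mul1 pres_1mul.

End Presentation.

Definition monoid_isomorphic (M N : monoidType) : Prop :=
  exists f : M -> N,
    [/\ bijective f, f 1%g = 1%g & {morph f : x y / (x * y)%g}].

Definition finitely_presented_special (M : monoidType) : Prop :=
  exists (A : finType) (ws : seq (seq A)),
    monoid_isomorphic M (presented_monoid [seq (w, [::]) | w <- ws]).

(* multinomials only equips {malg int[M]} with a product when every unit of M
   is trivial; the convolution product is needed here for all monoids. *)
Section MonoidRing.
Variable M : monoidType.

Definition monoid_ring : Type := {malg int[M]}.

HB.instance Definition _ := GRing.Zmodule.on monoid_ring.

Implicit Types f g h : monoid_ring.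

Definition mr_one : monoid_ring := mkmalgU (1%g : M) (1 : int).
Definition mr_mul f g : monoid_ring :=
  \sum_(x <- msupp f) \sum_(y <- msupp g) mkmalgU (x * y)%g (f@_x * g@_y).

Lemma mr_mulw (d1 d2 : {fset M}) f g :
  (msupp f `<=` d1)%fset -> (msupp g `<=` d2)%fset ->
  mr_mul f g =
  \sum_(x <- d1) \sum_(y <- d2) mkmalgU (x * y)%g (f@_x * g@_y).
Proof.
move=> le1 le2; rewrite /mr_mul (big_fset_incl _ le1) /=.
  apply: eq_bigr => x _; apply: big_fset_incl => // y _ /mcoeff_outdom ->.
  by rewrite mulr0 monalgU0.
move=> x _ /mcoeff_outdom fx.
by rewrite big1 // => y _; rewrite fx mul0r monalgU0.
Qed.

Lemma mr_mulUU (x y : M) (a b : int) :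
  mr_mul (mkmalgU x a) (mkmalgU y b) = mkmalgU (x * y)%g (a * b).
Proof. by rewrite (mr_mulw msuppU_le msuppU_le) !big_seq_fset1 !mcoeffUU. Qed.

Lemma mr_mulDl : left_distributive mr_mul +%R.
Proof.
move=> f g h.
rewrite (mr_mulw (msuppD_le f g) (fsubset_refl _)).
rewrite (mr_mulw (fsubsetUl (msupp f) (msupp g)) (fsubset_refl (msupp h))).
rewrite (mr_mulw (fsubsetUr (msupp f) (msupp g)) (fsubset_refl (msupp h))).
rewrite -big_split /=; apply: eq_bigr => x _.
rewrite -big_split /=; apply: eq_bigr => y _.
by rewrite mcoeffD mulrDl monalgUD.
Qed.

Lemma mr_mulDr : right_distributive mr_mul +%R.
Proof.
move=> h f g.
rewrite (mr_mulw (fsubset_refl _) (msuppD_le f g)).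
rewrite (mr_mulw (fsubset_refl (msupp h)) (fsubsetUl (msupp f) (msupp g))).
rewrite (mr_mulw (fsubset_refl (msupp h)) (fsubsetUr (msupp f) (msupp g))).
rewrite -big_split /=; apply: eq_bigr => x _.
rewrite -big_split /=; apply: eq_bigr => y _.
by rewrite mcoeffD mulrDr monalgUD.
Qed.

Lemma mr_mul0 : left_zero 0 mr_mul.
Proof. by move=> f; rewrite /mr_mul msupp0 big_seq_fset0. Qed.

Lemma mr_0mul : right_zero 0 mr_mul.
Proof.
by move=> f; rewrite /mr_mul big1 // => x _; rewrite msupp0 big_seq_fset0.
Qed.

Lemma mr_mul_suml I (s : seq I) (F : I -> monoid_ring) g :
  mr_mul (\sum_(i <- s) F i) g = \sum_(i <- s) mr_mul (F i) g.
Proof.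
exact: (big_morph (mr_mul^~ g) (fun _ _ => mr_mulDl _ _ _) (mr_mul0 g)).
Qed.

Lemma mr_mul_sumr I (s : seq I) (F : I -> monoid_ring) f :
  mr_mul f (\sum_(i <- s) F i) = \sum_(i <- s) mr_mul f (F i).
Proof.
exact: (big_morph (mr_mul f) (fun _ _ => mr_mulDr _ _ _) (mr_0mul f)).
Qed.

Lemma mr_mul1 : left_id mr_one mr_mul.
Proof.
move=> f; rewrite [in LHS](monalgE f) mr_mul_sumr [RHS]monalgE.
by apply: eq_bigr => x _; rewrite mr_mulUU mul1g mul1r.
Qed.

Lemma mr_1mul : right_id mr_one mr_mul.
Proof.
move=> f; rewrite [in LHS](monalgE f) mr_mul_suml [RHS]monalgE.
by apply: eq_bigr => x _; rewrite mr_mulUU mulg1 mulr1.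
Qed.

Lemma mr_mulA : associative mr_mul.
Proof.
move=> f g h; rewrite (monalgE f) (mr_mul_suml _ _ g) (mr_mul_suml _ _ h).
rewrite (mr_mul_suml _ _ (mr_mul g h)); apply: eq_bigr => x _.
set u := mkmalgU x _; rewrite (monalgE g) (mr_mul_suml _ _ h).
rewrite !(mr_mul_sumr _ _ u) (mr_mul_suml _ _ h); apply: eq_bigr => y _.
set v := mkmalgU y _; rewrite (monalgE h) (mr_mul_sumr _ _ v).
rewrite (mr_mul_sumr _ _ u) (mr_mul_sumr _ _ (mr_mul u v)).
by apply: eq_bigr => z _; rewrite !mr_mulUU mulgA mulrA.
Qed.

Lemma mr_one_neq0 : mr_one != 0.
Proof. by rewrite monalgU_eq0. Qed.

HB.instance Definition _ := GRing.Zmodule_isNzRing.Build monoid_ring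
  mr_mulA mr_mul1 mr_1mul mr_mulDl mr_mulDr mr_one_neq0.

Definition mr_of (x : M) : monoid_ring := mkmalgU x (1 : int).

Definition augmentation f : int := \sum_(x <- msupp f) f@_x.

Lemma augmentationw (d : {fset M}) f :
  (msupp f `<=` d)%fset -> augmentation f = \sum_(x <- d) f@_x.
Proof. by move=> le; apply: big_fset_incl => // x _ /mcoeff_outdom. Qed.

Lemma augmentationU (x : M) (a : int) : augmentation (mkmalgU x a) = a.
Proof. by rewrite (augmentationw msuppU_le) big_seq_fset1 mcoeffUU. Qed.

Lemma augmentationD : {morph augmentation : f g / f + g}.
Proof.
move=> f g; rewrite (augmentationw (msuppD_le f g)).
rewrite (augmentationw (fsubsetUl (msupp f) (msupp g))).
rewrite (augmentationw (fsubsetUr (msupp f) (msupp g))).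
by rewrite -big_split /=; apply: eq_bigr => x _; rewrite mcoeffD.
Qed.

Lemma augmentation0 : augmentation 0 = 0.
Proof. by rewrite /augmentation msupp0 big_seq_fset0. Qed.

Lemma augmentation1 : augmentation 1 = 1.
Proof. exact: augmentationU. Qed.

Lemma augmentationM : {morph augmentation : f g / f * g}.
Proof.
move=> f g; have -> : f * g = mr_mul f g by [].
rewrite /mr_mul (big_morph augmentation augmentationD augmentation0).
rewrite [X in _ = X * _]/augmentation mulr_suml; apply: eq_bigr => x _.
rewrite (big_morph augmentation augmentationD augmentation0).
rewrite [X in _ = _ * X]/augmentation mulr_sumr.
by apply: eq_bigr => y _; rewrite augmentationU.
Qed.

End MonoidRing.

(* The additive group Z, with one alias per module structure, since the
   carriers of a ring and of its converse are convertible. *)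
Definition trivial_left (M : monoidType) : Type := int.
Definition trivial_right (M : monoidType) : Type := int.

Section TrivialModules.
Variable M : monoidType.

Local Notation monoid_ring := (monoid_ring M).
Local Notation augmentation := (@augmentation M).

HB.instance Definition _ := GRing.Zmodule.on (trivial_left M).
HB.instance Definition _ := GRing.Zmodule.on (trivial_right M).

Definition trivial_left_scale (f : monoid_ring) (z : trivial_left M) :
  trivial_left M := augmentation f * (z : int).

Lemma trivial_left_scaleA f g z :
  trivial_left_scale f (trivial_left_scale g z) = trivial_left_scale (f * g) z.
Proof. by rewrite /trivial_left_scale augmentationM mulrA. Qed.

Lemma trivial_left_scale1 : left_id 1 trivial_left_scale.
Proof. by move=> z; rewrite /trivial_left_scale augmentation1 mul1r. Qed.

Lemma trivial_left_scaleDr : right_distributive trivial_left_scale +%R.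
Proof. by move=> f z t; rewrite /trivial_left_scale mulrDr. Qed.

Lemma trivial_left_scaleDl z :
  {morph trivial_left_scale^~ z : f g / f + g}.
Proof. by move=> f g; rewrite /trivial_left_scale augmentationD mulrDl. Qed.

HB.instance Definition _ :=
  GRing.Zmodule_isLmodule.Build monoid_ring (trivial_left M)
    trivial_left_scaleA trivial_left_scale1
    trivial_left_scaleDr trivial_left_scaleDl.

Definition trivial_right_scale (f : monoid_ring^c) (z : trivial_right M) :
  trivial_right M := augmentation f * (z : int).

Lemma trivial_right_scaleA (f g : monoid_ring^c) z :
  trivial_right_scale f (trivial_right_scale g z) =
  trivial_right_scale (f * g) z.
Proof.
rewrite /trivial_right_scale [in RHS]/GRing.mul /= augmentationM.
by rewrite mulrA [X in X * _]mulrC.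
Qed.

Lemma trivial_right_scale1 : left_id 1 trivial_right_scale.
Proof. exact: trivial_left_scale1. Qed.

Lemma trivial_right_scaleDr : right_distributive trivial_right_scale +%R.
Proof. exact: trivial_left_scaleDr. Qed.

Lemma trivial_right_scaleDl z :
  {morph trivial_right_scale^~ z : f g / f + g}.
Proof. exact: trivial_left_scaleDl. Qed.

HB.instance Definition _ :=
  GRing.Zmodule_isLmodule.Build monoid_ring^c (trivial_right M)
    trivial_right_scaleA trivial_right_scale1
    trivial_right_scaleDr trivial_right_scaleDl.

Lemma trivial_leftE (x : M) (z : trivial_left M) : mr_of x *: z = z.
Proof. by rewrite /GRing.scale /= /trivial_left_scale augmentationU mul1r. Qed.

Lemma trivial_rightE (x : M) (z : trivial_right M) :
  (mr_of x : monoid_ring^c) *: z = z.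
Proof. by rewrite /GRing.scale /= /trivial_right_scale augmentationU mul1r. Qed.

End TrivialModules.

Section Resolutions.
Variable R : nzRingType.

Definition surjective (U V : Type) (f : U -> V) : Prop :=
  forall v, exists u, f u = v.

Definition projective (P : lmodType R) : Prop :=
  forall (U V : lmodType R) (g : {linear U -> V}) (f : {linear P -> V}),
    surjective g -> exists h : {linear P -> U}, forall p, g (h p) = f p.

Definition finitely_generated (P : lmodType R) : Prop :=
  exists s : seq P, forall p : P,
    exists c : 'I_(size s) -> R, p = \sum_(i < size s) c i *: s`_i.

Record projective_resolution (V : lmodType R) := ProjectiveResolution {
  res_obj : nat -> lmodType R;
  res_diff : forall i, {linear res_obj i.+1 -> res_obj i};
  res_aug : {linear res_obj 0%N -> V};
  res_projective : forall i, projective (res_obj i);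
  res_aug_surj : surjective res_aug;
  res_exact0 : forall x, res_aug x = 0 <-> exists y, res_diff 0 y = x;
  res_exact : forall i x, res_diff i x = 0 <-> exists y, res_diff i.+1 y = x
}.

Definition module_FP (n : enat) (V : lmodType R) : Prop :=
  exists P : projective_resolution V,
    forall i : nat, enat_le i n -> finitely_generated (res_obj P i).

Definition length_at_most (V : lmodType R) (P : projective_resolution V)
  (n : nat) : Prop := forall i, (n < i)%N -> forall x : res_obj P i, x = 0.

Definition projective_dimension (V : lmodType R) : enat :=
  enat_least (fun n => exists P : projective_resolution V, length_at_most P n).

End Resolutions.

Definition left_FP (n : enat) (M : monoidType) : Prop :=
  module_FP n (trivial_left M : lmodType (monoid_ring M)).

(* Right ZM-modules are left modules over the converse ring. *)
Definition right_FP (n : enat) (M : monoidType) : Prop :=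
  module_FP n (trivial_right M : lmodType (monoid_ring M)^c).

Definition left_cd (M : monoidType) : enat :=
  projective_dimension (trivial_left M : lmodType (monoid_ring M)).

Definition right_cd (M : monoidType) : enat :=
  projective_dimension (trivial_right M : lmodType (monoid_ring M)^c).

(* On groups, inversion exchanges left and right modules, so either side
   gives the usual notions. *)
Definition group_FP (n : enat) (G : groupType) : Prop := left_FP n G.

Definition cd (G : groupType) : enat := left_cd G.

(* Main.v *)
From HB Require Import structures.
Require Import Defs.
From mathcomp Require Import all_boot all_algebra.
From mathcomp Require Import generic_quotient finmap monalg boolp zify.

(** Write [G] for the group of units of [M]. Among the presentations of [M] as a
    quotient of [H * A^*], with [H] a subgroup of [G] and finitely many rules
    [r_j = h_j] ([r_j] a word over [H] and [A] containing a letter, [h_j] in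
    [H]), choose one of minimal weight. Minimality forbids splitting a rule at a
    proper factor that is a unit (otherwise adjoin that unit to [H]) and
    rewriting a rule with another one. So left-hand sides neither overlap nor
    nest, the irreducible words [g_0 a_1 g_1 ... a_n g_n] are normal forms for
    [M], and [H = G]. In particular [G] acts freely on both sides of [M], the
    first and last coefficients being equivariant maps to [G].

    The normal forms give an explicit contraction of the complex
    [0 -> ZM^J -> ZM^A -> Z[M/G] -> Z -> 0] ([J] the set of rules): [Z[M/G]] goes
    to [ZM^A] by reading off the normal form, and [ZM^A] goes to [ZM^J] by
    detecting when appending a letter completes the left-hand side of a rule.
    Splicing it with the resolution of [Z[M/G]] induced from a resolution of
    [Z] over [ZG] bounds the finiteness properties and the dimension of [M] from
    above, and restriction to [ZG] gives the lower bound. Right modules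
    are left modules over the opposite monoid, which is again special. *)

Set Implicit Arguments.
Unset Strict Implicit.
Unset Printing Implicit Defensive.

(** * Normal forms in special monoids *)

Local Open Scope group_scope.

Lemma unit_valM (M : monoidType) (g h : units M) :
  unit_val (g * h) = unit_val g * unit_val h.
Proof. by []. Qed.

Lemma unit_valVg (M : monoidType) (g : units M) :
  unit_val g^-1 * unit_val g = 1.
Proof. by rewrite -unit_valM mulVg. Qed.

Lemma unit_valgV (M : monoidType) (g : units M) :
  unit_val g * unit_val g^-1 = 1.
Proof. by rewrite -unit_valM mulgV. Qed.

Lemma cat_eq_cat (T : Type) (u v x y : seq T) : u ++ x = v ++ y ->
  (exists w, u = v ++ w /\ y = w ++ x) \/ (exists w, v = u ++ w /\ x = w ++ y).
Proof.
elim: u v => [|a u IH] [|b v] /= E.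
- by left; exists [::].
- by right; exists (b :: v).
- by left; exists (a :: u).
- case: E => <- /IH[[w [-> ->]]|[w [-> ->]]]; first by left; exists w.
  by right; exists w.
Qed.

(** The hypotheses give [m] a left and a right inverse. The lemma is applied to the overlap [m] of
    two words whose values are units. *)
Lemma unit_of_factor (M : monoidType) (x m z : M) (g h : units M) :
  x * m = unit_val g -> m * z = unit_val h -> exists y, m = unit_val y.
Proof.
move=> xm mz; have [|y yE] := (unit_val_codom m).2; last by exists y.
have lm : unit_val g^-1 * x * m = 1 by rewrite -mulgA xm unit_valVg.
have mr : m * (z * unit_val h^-1) = 1 by rewrite mulgA mz unit_valgV.
exists (z * unit_val h^-1); split=> //.
by rewrite -{1}[z * _]mul1g -lm -(mulgA _ m) mr mulg1.
Qed.

(** * Words, rules and presentations with unit coefficients *)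

Section Words.
Variables (M : monoidType) (A : finType) (iota : A -> M).
Local Notation G := (units M).

(** Each unit precedes its letter, so a unit after the last letter has to be stored separately. *)
Definition word : Type := seq (G * A).
(* [(a, t, h)] stands for the relation [a t = h]: relations are normalised so
   that both ends of the left-hand side are letters. *)
Definition rule : Type := A * word * G.

Definition ev (w : word) : M :=
  foldr (fun p m => unit_val p.1 * (iota p.2 * m)) 1 w.

Lemma ev_cat u v : ev (u ++ v) = ev u * ev v.
Proof.
by elim: u => [|p u IH] /=; rewrite ?mul1g // IH !mulgA.
Qed.

Lemma ev_rcons u p : ev (rcons u p) = ev u * (unit_val p.1 * iota p.2).
Proof. by rewrite -cats1 ev_cat /= mulg1. Qed.

Definition rule_ev (r : rule) : M := iota r.1.1 * ev r.1.2.
Definition rule_valid (r : rule) : Prop := rule_ev r = unit_val r.2.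

Definition subgroup (H : G -> Prop) : Prop :=
  [/\ H 1, forall g h, H g -> H h -> H (g * h) & forall g, H g -> H g^-1].

Definition rule_in (H : G -> Prop) (r : rule) : Prop :=
  (forall p, p \in r.1.2 -> H p.1) /\ H r.2.

Definition word_act (X : Type) (xg : X -> G -> X) (xa : X -> A -> X)
  (x : X) (w : word) : X := foldl (fun y p => xa (xg y p.1) p.2) x w.

Definition rule_holds (X : Type) (xg : X -> G -> X) (xa : X -> A -> X)
    (r : rule) : Prop :=
  forall x, word_act xg xa (xa x r.1.1) r.1.2 = xg x r.2.

(** The values of [xg] outside the subgroup [H] are arbitrary; this lets [H] stay a predicate on
    [G]. *)
Definition is_action (H : G -> Prop) (X : Type) (xg : X -> G -> X) : Prop :=
  (forall x, xg x 1 = x) /\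
  (forall x g h, H g -> H h -> xg x (g * h) = xg (xg x g) h).

Definition extends_action (H : G -> Prop) X (xg : X -> G -> X)
    (xa : X -> A -> X) (xm : X -> M -> X) : Prop :=
  [/\ forall x, xm x 1 = x,
      forall x m n, xm x (m * n) = xm (xm x m) n,
      forall x a, xm x (iota a) = xa x a
    & forall x g, H g -> xm x (unit_val g) = xg x g].

(* The universal property of the quotient of H * A^* by the rules, tested on
   right actions only. *)
Definition presents (H : G -> Prop) (R : seq rule) : Prop :=
  forall (X : Type) (xg : X -> G -> X) (xa : X -> A -> X),
  is_action H xg -> (forall r, r \in R -> rule_holds xg xa r) ->
  exists xm : X -> M -> X, extends_action H xg xa xm.

Definition presentation (H : G -> Prop) (R : seq rule) : Prop :=
  [/\ subgroup H, forall r, r \in R -> rule_valid r,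
      forall r, r \in R -> rule_in H r & presents H R].

(* A left-hand side of length n counts for [2 n - 1] and not for [n], so that
   splitting it in two lowers the weight. *)
Definition weight (R : seq rule) : nat :=
  sumn [seq (size r.1.2).*2.+1 | r <- R].

Inductive gen (H : G -> Prop) (y : G) : G -> Prop :=
| gen_in g : H g -> gen H y g
| gen_new : gen H y y
| genM g h : gen H y g -> gen H y h -> gen H y (g * h)
| genV g : gen H y g -> gen H y g^-1.

Lemma subgroup_gen H y : subgroup H -> subgroup (gen H y).
Proof.
by case=> H1 _ _; split; [exact: gen_in|exact: genM|exact: genV].
Qed.

Lemma is_action_sub (H K : G -> Prop) X (xg : X -> G -> X) :
  (forall g, H g -> K g) -> is_action K xg -> is_action H xg.
Proof. by move=> HK [x1 xM]; split=> // x g h /HK Kg /HK Kh; apply: xM. Qed.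

Lemma word_actE H X (xg : X -> G -> X) xa xm w x :
  extends_action H xg xa xm -> (forall p, p \in w -> H p.1) ->
  word_act xg xa x w = xm x (ev w).
Proof.
case=> xm1 xmM xma xmg; elim: w x => [|p w IH] x win /=; first by rewrite xm1.
rewrite !xmM xmg ?xma ?IH //; last by apply: win; rewrite inE eqxx.
by move=> q qw; apply: win; rewrite inE qw orbT.
Qed.

(** A Tietze move: once [y] is adjoined to [H], the rule a c g b d = h is equivalent to the two
    rules b d = y and a c = h (g y)^-1. The weight drops by exactly one. *)
Lemma presentation_split H R1 R2 a c g b d h y :
  presentation H (R1 ++ (a, c ++ (g, b) :: d, h) :: R2) ->
  iota b * ev d = unit_val y ->
  presentation (gen H y)
    (R1 ++ (b, d, y) :: (a, c, h * (g * y)^-1) :: R2).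
Proof.
move=> [sH Rv Rin Rp] ydef.
set r := (a, _, h) in Rv Rin Rp; set R := R1 ++ _ in Rv Rin Rp.
set R' := R1 ++ _.
have rR : r \in R by rewrite mem_cat inE eqxx orbT.
have [rin hin] := Rin _ rR.
have gin : H g by apply: (rin (g, b)); rewrite mem_cat inE eqxx orbT.
have R'P (P : rule -> Prop) : (forall q, q \in R -> P q) ->
    P (b, d, y) -> P (a, c, h * (g * y)^-1) -> forall q, q \in R' -> P q.
  move=> PR P1 P2 q; rewrite mem_cat !inE => /or4P[qR|/eqP->|/eqP->|qR] //.
    by apply: PR; rewrite mem_cat qR.
  by apply: PR; rewrite mem_cat inE qR !orbT.
split; first exact: subgroup_gen.
- apply: R'P => //; rewrite /rule_valid /rule_ev /=.
  rewrite unit_valM -(Rv _ rR) /rule_ev /= ev_cat /= ydef.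
  rewrite -unit_valM mulgA -[LHS]mulg1 -(unit_valgV (g * y)) !mulgA.
  by [].
- apply: R'P => [q /Rin[qin1 qin2]||].
  + by split; [move=> p /qin1; exact: gen_in|exact: gen_in].
  + split; last exact: gen_new.
    move=> p pd; apply/gen_in/rin.
    by rewrite mem_cat inE pd !orbT.
  + split; last first.
      by apply: genM (gen_in _ hin) _; apply/genV/genM/gen_new/gen_in.
    by move=> p pc; apply/gen_in/rin; rewrite mem_cat pc.
- move=> X xg xa act hold.
  have [act1 actM] := act.
  have hyl : rule_holds xg xa (b, d, y).
    by apply: hold; rewrite mem_cat !inE eqxx orbT.
  have hcl : rule_holds xg xa (a, c, h * (g * y)^-1).
    by apply: hold; rewrite mem_cat !inE eqxx !orbT.
  have := Rp X xg xa (is_action_sub (@gen_in H y) act).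
  case=> [q|xm xmE].
    rewrite mem_cat inE => /or3P[qR|/eqP->|qR]; last 2 first.
    (* The old rule follows from the two new ones, because h (g y)^-1 g y = h. *)
    - move=> x; rewrite /= /word_act foldl_cat /=.
      have := hcl x; rewrite /word_act /= => ->.
      have := hyl (xg (xg x (h * (g * y)^-1)) g); rewrite /word_act /= => ->.
      rewrite -!actM ?mulgA; last 1 first.
      all: try (by repeat (exact: gen_new || exact: gen_in ||
                 apply: genM || apply: genV)).
      by rewrite -(mulgA _ g y) -mulgA mulVg mulg1.
    - by apply: hold; rewrite mem_cat !inE qR !orbT.
    - by apply: hold; rewrite mem_cat qR.
  have [xm1 xmM xma xmg] := xmE.
  exists xm; split=> // x k Kk.
  (* The action of [M] obtained from the old rules agrees with [xg] on [H]. At [y] it agrees by y =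
     b d and the new rule, and agreement then passes to products and inverses. *)
  elim: Kk x => {k} [k /xmg//||k l Kk IHk Kl IHl|k Kk IH] x.
  + rewrite -ydef xmM xma -(hyl x) /= (word_actE _ xmE) // => p pd.
    by apply/rin; rewrite mem_cat inE pd !orbT.
  + by rewrite unit_valM xmM IHk IHl actM.
  + have {1}-> : x = xg (xg x k^-1) k.
      by rewrite -actM ?mulVg ?act1 //; exact: genV.
    by rewrite -IH -xmM unit_valgV xm1.
Qed.
(** A Tietze move: the factor b t' is replaced by the unit [h'], which is absorbed into the
    coefficient of the next letter [c]. A factor at the very end has no next letter and is left to
    [presentation_split]. *)
Lemma presentation_subst H R1 R2 a u k b t' g c v h h' :
  presentation H (R1 ++ (a, u ++ (k, b) :: t' ++ (g, c) :: v, h) :: R2) ->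
  (b, t', h') \in R1 ++ R2 ->
  presentation H (R1 ++ (a, u ++ (k * h' * g, c) :: v, h) :: R2).
Proof.
move=> [sH Rv Rin Rp] r'R; have [H1 HM HV] := sH.
set r := (a, _, h) in Rv Rin Rp; set R := R1 ++ _ in Rv Rin Rp.
set R' := R1 ++ _.
have rR : r \in R by rewrite mem_cat inE eqxx orbT.
have {}r'R : (b, t', h') \in R.
  by move: r'R; rewrite !mem_cat inE => /orP[->|->]; rewrite ?orbT.
have [rin hin] := Rin _ rR; have [_ h'in] := Rin _ r'R.
have kin : H k by apply: (rin (k, b)); rewrite mem_cat inE eqxx orbT.
have gin : H g.
  by apply: (rin (g, c)); rewrite mem_cat inE mem_cat inE eqxx !orbT.
have R'P (P : rule -> Prop) : (forall q, q \in R -> P q) ->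
    P (a, u ++ (k * h' * g, c) :: v, h) -> forall q, q \in R' -> P q.
  move=> PR P1 q; rewrite mem_cat !inE => /or3P[qR|/eqP->|qR] //.
    by apply: PR; rewrite mem_cat qR.
  by apply: PR; rewrite mem_cat inE qR !orbT.
split=> //.
- apply: R'P => //; rewrite /rule_valid /rule_ev /= -(Rv _ rR).
  have r'E : unit_val h' = iota b * ev t' := esym (Rv _ r'R).
  by rewrite /rule_ev /= !ev_cat /= ev_cat /= !unit_valM r'E !mulgA.
- apply: R'P => //; split=> //= p.
  rewrite mem_cat inE => /or3P[pu|/eqP->|pv].
  + by apply: rin; rewrite mem_cat pu.
  + by apply: (HM _ _ _ gin); apply: HM.
  + by apply: rin; rewrite mem_cat inE mem_cat inE pv !orbT.
- move=> X xg xa act hold; have [act1 actM] := act.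
  apply: Rp => // q; rewrite mem_cat inE => /or3P[qR|/eqP->|qR].
  + by apply: hold; rewrite mem_cat qR.
  + move=> x; rewrite /= /word_act foldl_cat /= foldl_cat /=.
    have r'hold : rule_holds xg xa (b, t', h').
      apply: hold; move: r'R; rewrite mem_cat inE.
      (* The rule used for rewriting is not the rewritten one, whose left-hand side is longer. *)
      case/or3P=> [qR|/eqP[_ /(congr1 size)]|qR]; first by rewrite mem_cat qR.
        by rewrite size_cat /= size_cat /= => E; exfalso; lia.
      by rewrite mem_cat inE qR !orbT.
    have := r'hold (xg (word_act xg xa (xa x a) u) k).
    rewrite /word_act /= => ->.
    have := hold (a, u ++ (k * h' * g, c) :: v, h).
    rewrite mem_cat inE eqxx orbT => /(_ isT x).
    by rewrite /= /word_act foldl_cat /= !actM //; apply: HM.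
  + by apply: hold; rewrite mem_cat inE qR !orbT.
Qed.

(** * Consequences of minimal weight *)

Definition minimal_presentation (H : G -> Prop) (R : seq rule) : Prop :=
  presentation H R /\
  forall H' R', presentation H' R' -> (weight R <= weight R')%N.

Lemma exists_minimal H R :
  presentation H R -> exists H' R', minimal_presentation H' R'.
Proof.
move=> HR; pose P n := `[< exists H' R', presentation H' R' /\ weight R' = n >].
have exP : exists n, P n by exists (weight R); apply/asboolP; exists H, R.
case: (ex_minnP exP) => n /asboolP[H' [R' [HR' nE]]] nmin.
exists H', R'; split=> // H2 R2 HR2; rewrite nE; apply: nmin.
by apply/asboolP; exists H2, R2.
Qed.

Lemma weight_cat R1 R2 : weight (R1 ++ R2) = (weight R1 + weight R2)%N.
Proof. by rewrite /weight map_cat sumn_cat. Qed.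

Lemma minimal_no_split H R a c g b d h y :
  minimal_presentation H R -> (a, c ++ (g, b) :: d, h) \in R ->
  iota b * ev d <> unit_val y.
Proof.
move=> [HR Rmin] rR ydef; case/splitPr: R / rR HR Rmin => R1 R2.
move=> /presentation_split/(_ ydef) HR' /(_ _ _ HR').
by rewrite !weight_cat /weight /= size_cat /=; lia.
Qed.

(** If [v] is empty, the nested left-hand side is a suffix with unit value, excluded by
    [minimal_no_split]; otherwise [presentation_subst] lowers the weight. Nesting at the first
    letter is the subject of [minimal_no_prefix]. *)
Lemma minimal_no_nesting H R a u k b t' v h h' :
  minimal_presentation H R -> (b, t', h') \in R ->
  (a, u ++ (k, b) :: t' ++ v, h) \notin R.
Proof.
move=> Rm r'R; apply/negP => rR; case: v rR => [|[g c] v] rR.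
  rewrite cats0 in rR; apply: (minimal_no_split (y := h') Rm rR).
  by case: Rm => -[_ Rv _ _] _; exact: Rv r'R.
case: Rm => HR Rmin; case/splitPr: R / rR r'R HR Rmin => R1 R2 r'R.
have {}r'R : (b, t', h') \in R1 ++ R2.
  move: r'R; rewrite !mem_cat inE.
  case/or3P=> [->|/eqP[_ /(congr1 size)]|->]; rewrite ?orbT //.
  by rewrite size_cat /= size_cat /= => E; exfalso; lia.
move=> /presentation_subst/(_ r'R) HR' /(_ _ _ HR').
by rewrite !weight_cat /weight /= !size_cat /= ?size_cat /=; lia.
Qed.

(** Dividing the longer relation by the shorter one shows that the remaining suffix is a unit up to
    its first coefficient, so the longer rule could be split there. *)
Lemma minimal_no_prefix H R a t h e h' :
  minimal_presentation H R -> (a, t, h) \in R -> (a, t ++ e, h') \in R ->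
  e = [::].
Proof.
case: e => // -[g b] e Rm rR r'R; exfalso.
apply: (minimal_no_split (y := g^-1 * h^-1 * h') Rm r'R).
have [[_ Rv _ _] _] := Rm.
have := Rv _ r'R; have := Rv _ rR; rewrite /rule_valid /rule_ev /= ev_cat mulgA.
move=> -> /(congr1 (fun m => unit_val (g^-1 * h^-1) * m)).
rewrite -unit_valM => <- /=; rewrite !unit_valM !mulgA.
by rewrite -(mulgA (unit_val g^-1)) unit_valVg mulg1 unit_valVg mul1g.
Qed.

Lemma minimal_rule_functional H R a t h h' :
  minimal_presentation H R -> (a, t, h) \in R -> (a, t, h') \in R -> h = h'.
Proof.
case=> -[_ Rv _ _] _ /Rv + /Rv; rewrite /rule_valid /rule_ev /= => -> ?.
exact: unit_val_inj.
Qed.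

(** * Rewriting to normal forms *)

Section NormalForms.
Variables (H : G -> Prop) (R : seq rule).
Hypothesis Rmin : minimal_presentation H R.

Let sH : subgroup H. Proof. by case: Rmin => -[]. Qed.
Let Rvalid r : r \in R -> rule_ev r = unit_val r.2.
Proof. by case: Rmin => -[_ Rv _ _] _; exact: Rv. Qed.
Let Rin r : r \in R -> rule_in H r.
Proof. by case: Rmin => -[_ _ Ri _] _; exact: Ri. Qed.

Definition irreducible (s : word) : Prop :=
  forall r u k v, r \in R -> s <> u ++ (k, r.1.1) :: r.1.2 ++ v.

Definition matches (s : word) (q : word * G * rule) : Prop :=
  q.2 \in R /\ s = q.1.1 ++ (q.1.2, q.2.1.1) :: q.2.1.2.

(** Of two left-hand sides ending at the same place, the shorter would be nested in the longer; if
    they coincide, so do the rules. *)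
Lemma matches_uniq s q q' : matches s q -> matches s q' -> q = q'.
Proof.
case: q q' => [[u k] [[a t] h]] [[u' k'] [[a' t'] h']] [/= rR ->] [/= r'R].
have nested x b y l d p f : (b, y, l) \in R -> (x, p, f) \in R ->
    forall w, p <> w ++ (d, b) :: y.
  move=> bR pR w pE; move: pR; rewrite pE -(cats0 y).
  by apply/negP; exact: minimal_no_nesting Rmin bR.
case/cat_eq_cat=> -[[|p w] [-> E]].
- by case: E r'R => -> -> ->; rewrite cats0 => /(minimal_rule_functional Rmin rR)->.
- by case: E => _ /(nested _ _ _ _ _ _ _ rR r'R).
- by case: E rR => -> -> -> rR; rewrite cats0 (minimal_rule_functional Rmin rR r'R).
- by case: E => _ /(nested _ _ _ _ _ _ _ r'R rR).
Qed.

(** Only a proper prefix of the left-hand side of [r] is appended. A left-hand side starting inside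
    it would be a prefix of that of [r] or nested in it. One starting in [s] and reaching into it
    would overlap that of [r] in a factor which is a unit by [unit_of_factor], so the rule on the
    left could be split. *)
Lemma irreducible_push s g r p q e :
  irreducible s -> r \in R -> r.1.2 = p ++ q :: e ->
  irreducible (s ++ (g, r.1.1) :: p).
Proof.
move=> irrs rR tE [[b t] h] u k v r'R /=.
case: r tE rR => [[a _] h'] /= -> rR.
have clash w : (g, a) :: p <> w ++ (k, b) :: t ++ v.
  case: w => [[_ aE pE]|x w [_ pE]].
    move: rR; rewrite pE aE -catA => rR.
    have /(congr1 size) := minimal_no_prefix Rmin r'R rR.
    by rewrite size_cat /= addnS.
  move: rR; rewrite pE -catA /= -catA; apply/negP.
  exact: minimal_no_nesting Rmin r'R.
case/cat_eq_cat=> -[w [sE E]]; last exact: clash E.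
case: w => [|x w] in sE E; first exact: (clash [::] (esym E)).
case: E sE => <- /cat_eq_cat[] [w' [wE E]] sE.
  case: w' => [|y d] in wE E.
    by apply: (irrs (b, t, h) u k [::] r'R); rewrite sE wE !cats0.
  case: E wE => <- pE tE.
  have [y' yE] : exists y', iota a * ev d = unit_val y'.
    apply: (@unit_of_factor _ (iota b * ev w * unit_val g) _
      (ev (v ++ q :: e)) h h').
      by rewrite -(Rvalid r'R) /rule_ev /= tE ev_cat /= !mulgA.
    by rewrite -(Rvalid rR) /rule_ev /= pE -catA !ev_cat !mulgA.
  by move: r'R; rewrite tE => /(minimal_no_split Rmin)/(_ yE).
by apply: (irrs (b, t, h) u k w' r'R); rewrite sE wE.
Qed.

Lemma irreducible_prefix u v : irreducible (u ++ v) -> irreducible u.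
Proof.
move=> irr r u' k v' rR uE; apply: (irr r u' k (v' ++ v)) => //.
by rewrite uE -!catA /= -catA.
Qed.

Lemma irreducible_nil : irreducible [::].
Proof. by move=> r [|? ?] k v. Qed.

(** The rule completed by the last letter of [s], if any; by [matches_uniq] the choice made here is
    forced. *)
Definition trigger (s : word) : option (word * G * rule) :=
  if pselect (exists q, matches s q) is left ex
  then Some (projT1 (cid ex)) else None.

Lemma triggerP s q : trigger s = Some q <-> matches s q.
Proof.
rewrite /trigger; case: pselect => [ex|nex]; split=> //.
- by case=> <-; case: cid.
- by case: cid => q' /= m m'; rewrite (matches_uniq m m').
- by move=> m; case: nex; exists q.
Qed.

Lemma trigger_irreducible s : irreducible s -> trigger s = None.
Proof.
move=> irrs; case E: trigger => [[[u k] r]|] //.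
have [rR /=] := (triggerP _ _).1 E.
by rewrite -(cats0 r.1.2) => /(irrs r u k [::] rR).
Qed.

Lemma irreducible_rcons s p :
  irreducible s -> trigger (rcons s p) = None -> irreducible (rcons s p).
Proof.
move=> irrs tN r u k v rR; case: (lastP v) => [|{}v y] sE.
  suff: trigger (rcons s p) = Some (u, k, r) by rewrite tN.
  by apply/triggerP; split=> //=; rewrite sE cats0.
apply: (irrs r u k v rR).
by move: sE; rewrite -rcons_cat -rcons_cons -rcons_cat => /rcons_inj[].
Qed.

(** One step is enough for the words that arise: after a letter is appended to an irreducible word,
    a left-hand side can only sit at the end, and removing it leaves a prefix of the old word. The
    second component is the unit following the last letter. *)
Definition reduce (s : word) : word * G :=
  if trigger s is Some (u, k, r) then (u, k * r.2) else (s, 1).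

Definition state_mulg (x : word * G) (g : G) : word * G := (x.1, x.2 * g).
Definition state_mula (x : word * G) (a : A) : word * G :=
  reduce (rcons x.1 (x.2, a)).
Definition state_ev (x : word * G) : M := ev x.1 * unit_val x.2.

Lemma reduce_match r u k :
  r \in R -> reduce (u ++ (k, r.1.1) :: r.1.2) = (u, k * r.2).
Proof. by move=> rR; rewrite /reduce (triggerP _ (u, k, r)).2. Qed.

Lemma reduce_irreducible s : irreducible s -> reduce s = (s, 1).
Proof. by move=> irrs; rewrite /reduce trigger_irreducible. Qed.

Lemma state_ev_reduce s : state_ev (reduce s) = ev s.
Proof.
rewrite /reduce; case E: trigger => [[[u k] r]|] /=; last exact: mulg1.
have [rR /= ->] := (triggerP _ _).1 E; rewrite /state_ev /= ev_cat /=.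
by rewrite unit_valM -(Rvalid rR) /rule_ev.
Qed.

Lemma state_ev_mulg x g : state_ev (state_mulg x g) = state_ev x * unit_val g.
Proof. by rewrite /state_ev unit_valM mulgA. Qed.

Lemma state_ev_mula x a : state_ev (state_mula x a) = state_ev x * iota a.
Proof. by rewrite state_ev_reduce ev_rcons mulgA. Qed.

Definition normal_state (x : word * G) : Prop :=
  [/\ irreducible x.1, forall p, p \in x.1 -> H p.1 & H x.2].

Lemma normal1 : normal_state ([::], 1).
Proof. by split=> //; [exact: irreducible_nil|case: sH]. Qed.

Lemma normal_mulg x g : normal_state x -> H g -> normal_state (state_mulg x g).
Proof. by case=> irrx xH xH2 gH; split=> //; case: sH => _ + _; apply. Qed.

Lemma normal_mula x a : normal_state x -> normal_state (state_mula x a).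
Proof.
case: x => s g [/= irrs sin gin]; rewrite /state_mula /reduce.
have [H1 HM _] := sH; case E: trigger => [[[u k] r]|] /=; last first.
  split=> //=; first exact: irreducible_rcons.
  by move=> p; rewrite mem_rcons inE => /orP[/eqP->|/sin].
have [rR /= sE] := (triggerP _ _).1 E; have [_ rin] := Rin rR.
have in_s p : p \in u ++ (k, r.1.1) :: r.1.2 -> H p.1.
  by rewrite -sE mem_rcons inE => /orP[/eqP->|/sin].
split=> /=.
(* The completed left-hand side contains the appended letter, so what precedes it is a prefix of
   [s]. *)
- move: sE; case/lastP: (r.1.2) => [|t p]; rewrite ?cats1 -?rcons_cons -?rcons_cat.
    by case/rcons_inj=> <-.
  case/rcons_inj=> sE _.
  by apply: (@irreducible_prefix _ ((k, r.1.1) :: t)); rewrite -sE.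
- by move=> p pu; apply: in_s; rewrite mem_cat pu.
- by apply: HM => //; apply: (in_s (k, r.1.1)); rewrite mem_cat inE eqxx orbT.
Qed.

(** Reading the left-hand side letter by letter triggers nothing before its last letter, by
    [irreducible_push]; the last letter then triggers [r] itself. Hence the rules hold in the action
    on normal states. *)
Lemma state_rule s g r : irreducible s -> r \in R ->
  word_act state_mulg state_mula (state_mula (s, g) r.1.1) r.1.2 =
  (s, g * r.2).
Proof.
move=> irrs rR; rewrite -(reduce_match s g rR).
have prefix p q e : r.1.2 = p ++ q :: e ->
    word_act state_mulg state_mula (state_mula (s, g) r.1.1) p =
    (s ++ (g, r.1.1) :: p, 1).
  elim/last_ind: p q e => [|p q' IH] q e tE.
    rewrite /= /state_mula -cats1 reduce_irreducible //.
    exact: irreducible_push rR tE.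
  move: (tE); rewrite -cats1 -catA => tE'.
  rewrite /word_act foldl_cat /= -/(word_act _ _ _ _) (IH _ _ tE').
  rewrite /state_mula /= mul1g -cats1 -catA /= -surjective_pairing.
  by rewrite reduce_irreducible // cats1; exact: irreducible_push rR tE.
case/lastP tE: r.1.2 => [|p q]; first by rewrite /= /state_mula cats1.
rewrite /word_act -cats1 foldl_cat /= -/(word_act _ _ _ _).
rewrite (prefix p q [::]) ?cats1 // /state_mula /= mul1g -cats1.
by rewrite -catA /= cats1 -surjective_pairing.
Qed.

Hypothesis iota_gen : forall P : M -> Prop,
  P 1 -> (forall m a, P m -> P (m * iota a)) -> forall m, P m.

(** The argument of van der Waerden: by the universal property [M] acts on the normal states, and
    the normal form of [m] is the image of the empty state under [m]. *)
Lemma exists_normal_form : exists nf : M -> word * G,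
  [/\ forall m, normal_state (nf m), forall m, state_ev (nf m) = m
    & forall x, normal_state x -> nf (state_ev x) = x].
Proof.
pose X := {x : word * G | `[< normal_state x >]}.
have valN (x : X) : normal_state (val x) by apply/asboolP/(valP x).
pose mkX y (Ny : normal_state y) : X := exist _ y (asboolT Ny).
pose xa (x : X) a := mkX _ (normal_mula a (valN x)).
(* Outside [H] the value is a dummy, as the action is only tested on [H]. *)
pose xg (x : X) g := if pselect (H g) is left Hg
  then mkX _ (normal_mulg (valN x) Hg) else x.
have xgE x g : H g -> val (xg x g) = state_mulg (val x) g.
  by rewrite /xg; case: pselect.
have [H1 HM HV] := sH.
have xact : is_action H xg.
  split=> [x|x g h gH hH]; apply: val_inj; rewrite !xgE //.
  - by rewrite /state_mulg mulg1 -surjective_pairing.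
  - by rewrite /state_mulg /= mulgA.
  - exact: HM.
have word_val w x : (forall p, p \in w -> H p.1) ->
    val (word_act xg xa x w) = word_act state_mulg state_mula (val x) w.
  elim: w x => //= p w IH x wH; rewrite IH /= ?xgE //.
    by apply: wH; rewrite inE eqxx.
  by move=> q qw; apply: wH; rewrite inE qw orbT.
have xrule r : r \in R -> rule_holds xg xa r.
  move=> rR x; have [rin hin] := Rin rR; apply: val_inj.
  rewrite word_val // xgE //=; have [irrx _ _] := valN x.
  by rewrite [in LHS](surjective_pairing (val x)) state_rule.
have [[_ _ _ /(_ X xg xa xact xrule)[xm xmE]] _] := Rmin.
have [xm1 xmM xma xmg] := xmE.
pose x0 : X := mkX _ normal1.
have ev_xm x m : state_ev (val (xm x m)) = state_ev (val x) * m.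
  elim/iota_gen: m x => [x|m a IH x]; first by rewrite xm1 mulg1.
  by rewrite xmM xma /= state_ev_mula IH mulgA.
have ev0 : state_ev (val x0) = 1 by rewrite /state_ev /= mulg1.
exists (fun m => val (xm x0 m)); split=> [m|m|[s g] [/= irrs sin gin]].
- exact: valN.
- by rewrite ev_xm ev0 mul1g.
- rewrite /state_ev /= xmM xmg // xgE //.
  (* An irreducible word is rebuilt from the empty state without any reduction, since its prefixes
     are irreducible. *)
  suff -> : val (xm x0 (ev s)) = (s, 1) by rewrite /state_mulg mul1g.
  rewrite -(word_actE _ xmE) // word_val //=.
  elim/last_ind: s irrs sin => // s p IH irrs sin.
  rewrite /word_act -cats1 foldl_cat /= -/(word_act _ _ _ _) IH.
  + rewrite /state_mula /= mul1g -surjective_pairing cats1.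
    exact: reduce_irreducible.
  + by apply: (@irreducible_prefix _ [:: p]); rewrite cats1.
  + by move=> q qs; apply: sin; rewrite mem_rcons inE qs orbT.
Qed.

(** If the normal form of [y] had a letter, its concatenation with that of the inverse would again
    be normal, yet it has value 1 and is not empty. So [y] has a normal form without letters, which
    lies in [H]. *)
Lemma unit_in_subgroup y : H y.
Proof.
have [nf [nfN nfK nfE]] := exists_normal_form; have [H1 HM HV] := sH.
have nf1 : nf 1 = ([::], 1).
  by rewrite -(nfE _ normal1) /state_ev /= mulg1.
case xE: (nf (unit_val y)) => [s g]; case: s => [|p s] in xE.
  have [_ _ gH] := nfN (unit_val y); have := nfK (unit_val y).
  rewrite xE /state_ev /= mul1g => /unit_val_inj <-; by rewrite xE in gH.
exfalso; case zE: (nf (unit_val y^-1)) => [s' g'].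
have [] := nfN (unit_val y); have [] := nfN (unit_val y^-1); rewrite xE zE /=.
move=> irr' in' g'H irrs sin gin.
have yE := nfK (unit_val y); have y'E := nfK (unit_val y^-1).
rewrite xE zE /state_ev /= in yE y'E.
(* The last unit of the first word is merged into the first coefficient of the second or, if the
   second has no letter, into the trailing unit [k]. *)
pose merged : word :=
  if s' is q :: s'' then (p :: s) ++ (g * q.1, q.2) :: s'' else p :: s.
pose k := if s' is q :: s'' then g' else g * g'.
have mergedE : state_ev (merged, k) = 1.
  rewrite -(unit_valgV y) -yE -y'E /state_ev /merged /k.
  case: (s') => [|q s''] /=; first by rewrite unit_valM mul1g !mulgA.
  by rewrite ev_cat /= unit_valM !mulgA.
have merged0 : normal_state (merged, k) -> False.
  by move/nfE; rewrite mergedE nf1 /merged; case: (s').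
apply: merged0; split=> /=; last first.
- by rewrite /k; case: (s') => // ; exact: HM.
- rewrite /merged; case E: s' => [|q s'']; first exact: sin.
  move=> x; rewrite mem_cat in_cons => /or3P[/sin||] //.
    move/eqP=> -> /=; apply: HM => //; apply: in'; rewrite E inE eqxx //.
  by move=> xs; apply: in'; rewrite E in_cons; apply/orP; right.
- rewrite /merged; case E: s' => [|q s''] //.
  move=> [[a t] h] u u' v rR /= sE.
  rewrite E in irr' y'E.
  have right w : (g * q.1, q.2) :: s'' <> w ++ (u', a) :: t ++ v.
    case: w => [|c w] [].
      move=> _ qa tE; apply: (irr' _ [::] q.1 v rR).
      by rewrite /= -qa tE -surjective_pairing.
    by move=> _ tE; apply: (irr' _ (q :: w) u' v rR); rewrite tE.
  case/(@cat_eq_cat _ (p :: s)): sE => -[w [wE tE]]; last exact: right tE.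
  case: w => [|c w] in wE tE; first exact: (right [::] (esym tE)).
  case: tE wE => <- /cat_eq_cat[] [w' [w'E tE]] wE; last first.
    by apply: (irrs _ u u' w' rR); rewrite wE w'E.
  case: w' => [|x d] in w'E tE.
    by apply: (irrs _ u u' [::] rR); rewrite wE w'E !cats0.
  case: tE w'E => <- tE w'E.
  (* A left-hand side across the junction has its right part both as a suffix of a word of unit
     value and, up to [q.1], as a prefix of a word for the inverse of [y]; this part is a unit and
     splits the rule. *)
  have [y' yE'] : exists y', iota q.2 * ev d = unit_val y'.
    apply: (@unit_of_factor _ (iota a * ev w * unit_val (g * q.1)) _
      (ev v * unit_val g') h (q.1^-1 * y^-1)).
      by rewrite -(Rvalid rR) /rule_ev /= w'E ev_cat /= !mulgA.
    rewrite unit_valM -y'E /= tE ev_cat !mulgA unit_valVg mul1g.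
    by [].
  by move: rR; rewrite w'E => /(minimal_no_split Rmin)/(_ yE').
Qed.

Variable nf : M -> word * G.
Hypothesis nf_normal : forall m, normal_state (nf m).
Hypothesis nfK : forall m, state_ev (nf m) = m.
Hypothesis nfE : forall x, normal_state x -> nf (state_ev x) = x.

Lemma irreducible_normal s g : irreducible s -> normal_state (s, g).
Proof. by move=> irrs; split=> // *; exact: unit_in_subgroup. Qed.

Lemma nf_irreducible m : irreducible (nf m).1.
Proof. by have [] := nf_normal m. Qed.

Lemma nf1 : nf 1 = ([::], 1).
Proof. by rewrite -(nfE normal1) /state_ev /= mulg1. Qed.

Lemma nf_mulg m g : nf (m * unit_val g) = state_mulg (nf m) g.
Proof.
rewrite -{1}(nfK m) -state_ev_mulg nfE //.
by apply: normal_mulg => //; exact: unit_in_subgroup.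
Qed.

Lemma nf_mula m a : nf (m * iota a) = state_mula (nf m) a.
Proof. by rewrite -{1}(nfK m) -state_ev_mula nfE //; exact: normal_mula. Qed.

Definition last_unit (m : M) : G := (nf m).2.

Lemma last_unit_mulg m g : last_unit (m * unit_val g) = last_unit m * g.
Proof. by rewrite /last_unit nf_mulg. Qed.

Definition first_unit (m : M) : G :=
  if (nf m).1 is p :: _ then p.1 else (nf m).2.

(** Changing the first coefficient of a word preserves irreducibility, as left-hand sides begin with
    a letter. *)
Lemma first_unit_mulg g m : first_unit (unit_val g * m) = g * first_unit m.
Proof.
have mE := nfK m; rewrite /first_unit -{1 2}mE.
case E: (nf m) => [[|p s] h] /=.
  rewrite /state_ev /= mul1g -unit_valM -[unit_val _]mul1g.
  by rewrite (nfE (irreducible_normal _ irreducible_nil)).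
have irrs := @nf_irreducible m; rewrite E /= in irrs.
have irrgs : irreducible ((g * p.1, p.2) :: s).
  move=> r [|c u] k v rR [].
    move=> _ pa sE; apply: (irrs r [::] p.1 v rR).
    by rewrite -pa sE -surjective_pairing.
  by move=> _ sE; apply: (irrs r (p :: u) k v rR); rewrite sE.
have -> : unit_val g * state_ev (p :: s, h) = state_ev ((g * p.1, p.2) :: s, h).
  by rewrite /state_ev /= unit_valM !mulgA.
by rewrite nfE //; exact: irreducible_normal.
Qed.

End NormalForms.
End Words.

(** * The initial presentation of a special monoid *)

Section Special.
Variables (M : monoidType) (A : finType) (ws : seq (seq A)).
Let relations := [seq (w, [::] : seq A) | w <- ws].
Variable f : M -> presented_monoid relations.
Hypothesis f_bij : bijective f.
Hypothesis f1 : f 1 = 1.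
Hypothesis fM : {morph f : x y / x * y}.

(** The starting point has trivial [H], all coefficients 1 and one rule per nonempty relator; an
    empty relator imposes nothing and is dropped by [pmap]. *)
Lemma special_presentation : exists iota : A -> M,
  (forall P : M -> Prop, P 1 -> (forall m a, P m -> P (m * iota a)) ->
     forall m, P m) /\
  exists H R, presentation iota H R.
Proof.
case: f_bij => finv fK finvK.
have finv1 : finv 1 = 1 by rewrite -f1 fK.
have finvM : {morph finv : x y / x * y}.
  by move=> x y; apply: (can_inj fK); rewrite fM !finvK.
pose p w : presented_monoid relations := (\pi_(presented_monoid relations) w)%qT.
have pM u v : p (u ++ v) = p u * p v by exact: esym (pres_mulE _ _ _).
have reprP x : p (generic_quotient.repr x) = x by exact: reprK.
pose iota a := finv (p [:: a]).
have ev_word w : ev iota [seq (1, b) | b <- w] = finv (p w).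
  elim: w => [|b w IH] /=; first by rewrite -finv1.
  by rewrite IH mul1g -finvM -pM.
exists iota; split.
  move=> P P1 PM m; rewrite -(fK m) -(reprP (f m)).
  elim/last_ind: (generic_quotient.repr _) => [|w a IH].
    by rewrite (_ : p _ = 1) ?finv1.
  by rewrite -cats1 pM finvM; exact: PM.
pose rule_of (w : seq A) : option (rule M A) :=
  if w is a :: w' then Some (a, [seq (1, b) | b <- w'], 1) else None.
exists (fun g => g = 1), (pmap rule_of ws).
have relP w : w \in ws -> p w = 1.
  move=> wws; apply/eqP/pi_presP; rewrite -[w]cats0.
  by apply: (@pres_congr_step _ _ [::] [::] w [::]); apply/mapP; exists w.
have ruleP r : r \in pmap rule_of ws -> exists a w,
    a :: w \in ws /\ r = (a, [seq (1, b) | b <- w], 1).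
  by rewrite mem_pmap => /mapP[[|a w] //= wws [->]]; exists a, w.
split.
- by split=> // [g h -> ->|g ->]; rewrite ?mulg1 ?invg1.
- move=> r /ruleP[a [w [wws ->]]]; rewrite /rule_valid /rule_ev /= ev_word.
  by rewrite -finvM -pM relP // finv1.
- by move=> r /ruleP[a [w [_ ->]]]; split=> //= q /mapP[b _ ->].
- move=> X xg xa [act1 _] hold.
  (* The action of words factors through the congruence, so [M] can act through representatives. *)
  have congr_act u v : pres_congr relations u v ->
      forall x, foldl xa x u = foldl xa x v.
    elim=> {u v} [u v l r /mapP[w wws [-> ->]]|//|u v _ IH|v u w _ IHu _ IHw] x.
    + rewrite !foldl_cat; congr foldl; case: w wws => [|a w] // wws.
      have: (a, [seq (1, b) | b <- w], 1) \in pmap rule_of ws.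
        by rewrite mem_pmap; apply/mapP; exists (a :: w).
      move/hold => /(_ (foldl xa x u)); rewrite act1 /= => {2}<-.
      elim: w (xa _ a) {wws} => //= b w IH y.
      by rewrite IH act1.
    + by rewrite IH.
    + by rewrite IHu IHw.
  pose xm x m := foldl xa x (generic_quotient.repr (f m)).
  have xmE u m x : f m = p u -> xm x m = foldl xa x u.
    by move=> mE; apply/congr_act/pi_presP; rewrite reprK mE.
  exists xm; split.
  + by move=> x; apply: (xmE [::]); rewrite f1.
  + move=> x m n; pose w k := generic_quotient.repr (f k).
    rewrite (xmE (w m ++ w n)) ?foldl_cat //.
    by rewrite pM !reprP fM.
  + by move=> x a; apply: (xmE [:: a]); rewrite finvK.
  + by move=> x g ->; rewrite act1; apply: (xmE [::]); rewrite f1.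
Qed.
End Special.

Local Close Scope group_scope.

Import GRing.Theory.
Local Open Scope ring_scope.

(** * Resolutions *)

Section LinearOf.
Variables (R : nzRingType) (U V : lmodType R) (f : U -> V).
(** The proof of linearity is an argument, so that the structure can be inferred from the term,
    while its values still unfold to those of [f]. *)
Definition linear_of of linear f : U -> V := f.
HB.instance Definition _ (fl : linear f) :=
  GRing.isLinear.Build R U V *:%R (linear_of fl) fl.
Definition mk_linear (fl : linear f) : {linear U -> V} := linear_of fl.
End LinearOf.

Section AdditiveOf.
Variables (U V : zmodType) (f : U -> V).
Definition additive_of of {morph f : x y / x + y} : U -> V := f.
Variable fD : {morph f : x y / x + y}.
Lemma additive_of_subproof : zmod_morphism (additive_of fD).
Proof.
move=> x y; rewrite /additive_of; have f0 : f 0 = 0.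
  by apply: (addrI (f 0)); rewrite -fD !addr0.
rewrite fD; congr (_ + _); apply: (addrI (f y)).
by rewrite -fD !subrr f0.
Qed.
HB.instance Definition _ :=
  GRing.isZmodMorphism.Build U V (additive_of fD) additive_of_subproof.
Definition mk_additive : {additive U -> V} := additive_of fD.
End AdditiveOf.

Section MalgExt.
Variables (K : choiceType) (P V : zmodType).

Lemma malg_ind (Q : {malg P[K]} -> Prop) :
  Q 0 -> (forall x y, Q x -> Q y -> Q (x + y)) ->
  (forall k p, Q (mkmalgU k p)) -> forall x, Q x.
Proof. by move=> Q0 QD QU x; rewrite (monalgE x); elim/big_ind: _. Qed.

Variable f : K -> {additive P -> V}.

(** The additive map out of the direct sum of copies of [P] indexed by [K], given by [f k] on the
    copy at [k]. *)
Definition malg_ext (x : {malg P[K]}) : V := \sum_(k <- msupp x) f k x@_k.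

Lemma malg_extw (d : {fset K}) x : (msupp x `<=` d)%fset ->
  malg_ext x = \sum_(k <- d) f k x@_k.
Proof.
by move=> le; apply: big_fset_incl => // k _ /mcoeff_outdom ->; rewrite raddf0.
Qed.

Lemma malg_extU k p : malg_ext (mkmalgU k p) = f k p.
Proof. by rewrite (malg_extw msuppU_le) big_seq_fset1 mcoeffUU. Qed.

Lemma malg_ext_is_additive : {morph malg_ext : x y / x + y}.
Proof.
move=> x y; rewrite (malg_extw (msuppD_le x y)).
rewrite (malg_extw (fsubsetUl (msupp x) (msupp y))).
rewrite (malg_extw (fsubsetUr (msupp x) (msupp y))).
by rewrite -big_split /=; apply: eq_bigr => k _; rewrite mcoeffD raddfD.
Qed.

HB.instance Definition _ := GRing.isZmodMorphism.Build _ _ malg_ext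
  (additive_of_subproof malg_ext_is_additive).

End MalgExt.

(** * Restriction of scalars *)

Section Restriction.
Variables (R S : nzRingType) (phi : {rmorphism R -> S}).

(* The dummy [let] records [phi] in the type, so that the module structure can be
   inferred from it. *)
Definition restr (V : lmodType S) : Type := let _ := phi in V.

Section Module.
Variable V : lmodType S.
HB.instance Definition _ := GRing.Zmodule.on (restr V).

Definition restr_scale (a : R) (v : restr V) : restr V := phi a *: (v : V).

Lemma restr_scaleA a b v :
  restr_scale a (restr_scale b v) = restr_scale (a * b) v.
Proof. by rewrite /restr_scale rmorphM scalerA. Qed.
Lemma restr_scale1 : left_id 1 restr_scale.
Proof. by move=> v; rewrite /restr_scale rmorph1 scale1r. Qed.
Lemma restr_scaleDr : right_distributive restr_scale +%R.
Proof. by move=> a u v; rewrite /restr_scale scalerDr. Qed.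
Lemma restr_scaleDl v : {morph restr_scale^~ v : a b / a + b}.
Proof. by move=> a b; rewrite /restr_scale rmorphD scalerDl. Qed.

HB.instance Definition _ := GRing.Zmodule_isLmodule.Build R (restr V)
  restr_scaleA restr_scale1 restr_scaleDr restr_scaleDl.

Lemma restrE a (v : restr V) : a *: v = phi a *: (v : V).
Proof. by []. Qed.
End Module.

Lemma restr_linear_subproof (U V : lmodType S) (f : {linear U -> V}) :
  linear (f : restr U -> restr V).
Proof. by move=> a u v; rewrite !restrE linearP. Qed.

Definition restr_linear (U V : lmodType S) (f : {linear U -> V}) :
  {linear restr U -> restr V} := mk_linear (restr_linear_subproof f).

End Restriction.

(** * Transfer of resolutions along a ring isomorphism *)

Section IsoTransfer.
Variables (R S : nzRingType) (phi : {rmorphism R -> S}) (psi : {rmorphism S -> R}).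
Hypotheses (phiK : cancel phi psi) (psiK : cancel psi phi).

(** Restriction along the inverse [psi] turns a lifting problem over [R] into one over [S]. *)
Lemma projective_restr (P : lmodType S) :
  projective P -> projective (restr phi P).
Proof.
move=> Pproj U V g f gs.
have fl : linear (f : P -> restr psi V).
  move=> a u v; rewrite restrE.
  have := linearP f (psi a) (u : restr phi P) v.
  by rewrite restrE psiK.
have [h hE] := Pproj _ _ (restr_linear psi g) (mk_linear fl) gs.
have hl : linear (h : restr phi P -> U).
  move=> a u v; rewrite restrE.
  have := linearP h (phi a) (u : P) v.
  by rewrite restrE phiK.
by exists (mk_linear hl) => p; apply: hE.
Qed.

Lemma finitely_generated_restr (P : lmodType S) :
  finitely_generated P -> finitely_generated (restr phi P).
Proof.
case=> s sP; exists (s : seq (restr phi P)) => p; have [c ->] := sP p.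
by exists (psi \o c); apply: eq_bigr => i _; rewrite restrE /= psiK.
Qed.

Variables (V : lmodType S) (W : lmodType R) (theta : V -> W).
Hypothesis theta_linear : linear (theta : restr phi V -> W).
Hypothesis theta_bij : bijective theta.

Lemma transfer_aug_subproof (P : projective_resolution V) :
  linear (fun x : restr phi (res_obj P 0) => theta (res_aug P x)).
Proof.
move=> a u v; rewrite -theta_linear !restrE; congr theta.
exact: (linearP (res_aug P) (phi a) (u : res_obj P 0) v).
Qed.

(** Transparent, so that its modules unfold to the same underlying groups as those of [P], as
    [transfer_length] requires. *)
Definition transfer_resolution (P : projective_resolution V) :
  projective_resolution W.
Proof.
refine (@ProjectiveResolution R W (fun i => restr phi (res_obj P i))
  (fun i => restr_linear phi (res_diff P i)) 
  (mk_linear (@transfer_aug_subproof P)) _ _ _ _).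
- by move=> i; apply/projective_restr/res_projective.
- move=> w; have [eta _ etaK] := theta_bij.
  have [x xE] := res_aug_surj P (eta w); exists x.
  by rewrite -[LHS]/(theta (res_aug P x)) xE etaK.
- move=> x; rewrite -[_ <-> _]/(theta (res_aug P x) = 0 <-> _).
  have := @res_exact0 _ _ P x => <-; split=> [|->].
    have [eta thetaK _] := theta_bij => /(congr1 eta).
    by rewrite thetaK => ->; rewrite -(raddf0 (mk_linear theta_linear)) thetaK.
  exact: (raddf0 (mk_linear theta_linear)).
- exact: res_exact.
Defined.

Lemma transfer_FP n : module_FP n V -> module_FP n W.
Proof.
case=> P Pfg; exists (transfer_resolution P) => i /Pfg.
exact: finitely_generated_restr.
Qed.

Lemma transfer_length n (P : projective_resolution V) :
  length_at_most P n -> length_at_most (transfer_resolution P) n.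
Proof. by []. Qed.

End IsoTransfer.

Lemma enat_least_mono (P Q : nat -> Prop) :
  (forall n, P n -> Q n) -> enat_le (enat_least Q) (enat_least P).
Proof.
move=> PQ; rewrite /enat_least; case: pselect => [exQ|nexQ]; case: pselect => //.
  move=> exP; case: ex_minnP => m _ mmin; case: ex_minnP => n /asboolP/PQ Qn _.
  by apply: mmin; apply/asboolP.
by move=> exP; case: nexQ; case: exP => n /asboolP/PQ Qn; exists n; apply/asboolP.
Qed.

Lemma enat_least_max k (P Q : nat -> Prop) : (forall n, P n -> Q (maxn k n)) ->
  enat_le (enat_least Q) (enat_max k (enat_least P)).
Proof.
move=> PQ; rewrite /enat_least; case: (pselect (exists n, `[< P n >])).
  move=> exP /=; case: ex_minnP => n /asboolP/PQ Qn _; case: pselect => [exQ|[]].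
    by case: ex_minnP => m _; apply; apply/asboolP.
  by exists (maxn k n); apply/asboolP.
by move=> _ /=; case: pselect.
Qed.

(** * Projective and finitely generated modules *)

Section Projective.
Variable R : nzRingType.

Lemma projective_prod (P Q : lmodType R) :
  projective P -> projective Q -> projective (P * Q)%type.
Proof.
move=> Pproj Qproj U V g f gs.
have fPl : linear (fun p => f (p, 0)).
  move=> a p q; rewrite -linearP; apply: (congr1 f).
  by congr pair; rewrite /= scaler0 addr0.
have fQl : linear (fun p => f (0, p)).
  move=> a p q; rewrite -linearP; apply: (congr1 f).
  by congr pair; rewrite /= scaler0 addr0.
have [hP hPE] := Pproj _ _ _ (mk_linear fPl) gs.
have [hQ hQE] := Qproj _ _ _ (mk_linear fQl) gs.
have hl : linear (fun x : P * Q => hP x.1 + hQ x.2).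
  by move=> a x y; rewrite /= !linearP scalerDr addrACA.
exists (mk_linear hl) => -[p q].
have -> : (p, q) = (p, 0) + (0, q) by congr pair; rewrite /= ?addr0 ?add0r.
rewrite [RHS]raddfD -[LHS]/(g (hP (p + 0) + hQ (0 + q))) addr0 add0r.
by rewrite raddfD; exact: (congr2 +%R (hPE p) (hQE q)).
Qed.

(** An induction principle that avoids families of coefficients. Conversely, it is applied to the
    predicate of being a combination of [s]. *)
Lemma finitely_generatedP (P : lmodType R) :
  finitely_generated P <-> exists s : seq P, forall Q : P -> Prop,
    Q 0 -> (forall u v, Q u -> Q v -> Q (u + v)) ->
    (forall a u, Q u -> Q (a *: u)) -> (forall u, u \in s -> Q u) ->
    forall p, Q p.
Proof.
split=> -[s sP]; exists s.
  move=> Q Q0 QD QZ Qs p; have [c ->] := sP p.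
  by elim/big_ind: _ => // i _; apply/QZ/Qs/mem_nth.
apply: sP.
- by exists (fun _ => 0); rewrite big1 // => i _; rewrite scale0r.
- move=> _ _ [c ->] [d ->]; exists (fun i => c i + d i).
  by rewrite -big_split; apply: eq_bigr => i _; rewrite scalerDl.
- move=> a _ [c ->]; exists (fun i => a * c i).
  by rewrite scaler_sumr; apply: eq_bigr => i _; rewrite scalerA.
- move=> u us; have us' : (index u s < size s)%N by rewrite index_mem.
  exists (fun i => (i == Ordinal us')%:R).
  rewrite (bigD1 (Ordinal us')) //= eqxx scale1r nth_index // big1 ?addr0 //.
  by move=> i /negPf->; rewrite scale0r.
Qed.

Lemma finitely_generated_prod (P Q : lmodType R) :
  finitely_generated P -> finitely_generated Q ->
  finitely_generated (P * Q)%type.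
Proof.
move=> /finitely_generatedP[s sP] /finitely_generatedP[t tQ].
apply/finitely_generatedP.
exists ([seq (x, 0) | x <- s] ++ [seq (0, y) | y <- t]).
move=> X X0 XD XZ Xs [p q].
have -> : (p, q) = (p, 0) + (0, q) by congr pair; rewrite /= ?addr0 ?add0r.
apply: (XD).
- elim/sP: p => // [u v Xu Xv|a u Xu|u us].
  + suff -> : (u + v, 0) = (u, 0) + (v, 0) :> P * Q by exact: XD.
    by congr pair; rewrite /= addr0.
  + suff -> : (a *: u, 0) = a *: (u, 0) :> P * Q by exact: XZ.
    by congr pair; rewrite /= scaler0.
  + by apply: Xs; rewrite mem_cat map_f.
- elim/tQ: q => // [u v Xu Xv|a u Xu|u us].
  + suff -> : (0, u + v) = (0, u) + (0, v) :> P * Q by exact: XD.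
    by congr pair; rewrite /= addr0.
  + suff -> : (0, a *: u) = a *: (0, u) :> P * Q by exact: XZ.
    by congr pair; rewrite /= scaler0.
  + by apply: Xs; rewrite mem_cat orbC map_f.
Qed.

(** [g] only has to reach the values of [f]. Since [P] is a retract of the free module on its own
    elements, it suffices to choose lifts on that basis. *)
Lemma projective_lift (P U V : lmodType R) (g : {linear U -> V})
    (f : {linear P -> V}) :
  projective P -> (forall p, exists u, g u = f p) ->
  exists h : {linear P -> U}, forall p, g (h p) = f p.
Proof.
move=> Pproj fg.
have ext_linear (W : lmodType R) (w : P -> W) :
    exists h : {linear {malg R[P]} -> W}, forall p, h (mkmalgU p 1) = w p.
  have wD p : {morph (fun a : R => a *: w p) : a b / a + b}.
    by move=> a b; rewrite scalerDl.
  have hl : linear (malg_ext (fun p => mk_additive (wD p))).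
    move=> a x y; rewrite raddfD; congr (_ + _).
    apply: etrans (malg_extw _ (msuppZ_le a x)) _; rewrite scaler_sumr.
    by apply: eq_bigr => p _; rewrite mcoeffZ; exact: esym (scalerA _ _ _).
  by exists (mk_linear hl) => p; rewrite -[RHS]scale1r;
     exact: (malg_extU (fun q => mk_additive (wD q)) p 1).
have [u uE] := boolp.choice fg.
have [pi piE] := ext_linear P id; have [h hE] := ext_linear U u.
have pi_surj : surjective pi by move=> p; exists (mkmalgU p 1); rewrite piE.
have [s sE] := Pproj _ _ pi (idfun : {linear P -> P}) pi_surj.
have ghE : forall x, g (h x) = f (pi x).
  elim/malg_ind => [|x y IHx IHy|p a]; first by rewrite !linear0.
    by rewrite !linearD IHx IHy.
  have -> : mkmalgU p a = a *: mkmalgU p 1 :> {malg R[P]}.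
    by apply/malgP => q; rewrite mcoeffZ !mcoeffU mulrnAr mulr1.
  by rewrite !linearZ hE piE uE.
have sl : linear (fun p => h (s p)) by move=> a x y; rewrite !linearP.
by exists (mk_linear sl) => p; rewrite -[LHS]/(g (h (s p))) ghE sE.
Qed.

(* Splicing: an exact sequence [0 -> F2 -> F1 -> V -> W -> 0] and a resolution
   [L] of [V] yield the resolution
   [... -> L3 -> L2 + F2 -> L1 + F1 -> L0 -> W]. *)
Section Splice.
Variables (V W F1 F2 : lmodType R) (L : projective_resolution V).
Variables (d2 : {linear F2 -> F1}) (d1 : {linear F1 -> V}).
Variable (e : {linear V -> W}).
Hypotheses (F1proj : projective F1) (F2proj : projective F2).
Hypothesis e_surj : surjective e.
Hypothesis e_exact : forall v, e v = 0 <-> exists x, d1 x = v.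
Hypothesis d1_exact : forall x, d1 x = 0 <-> exists y, d2 y = x.
Hypothesis d2_inj : injective d2.

(** [f1] lifts [d1] through the augmentation; as d1 d2 = 0, the map f1 d2 lands in its kernel and
    lifts to degree 1. The sign makes consecutive spliced differentials compose to 0. *)
Lemma splice_lifts : exists (f1 : {linear F1 -> res_obj L 0})
    (f2 : {linear F2 -> res_obj L 1}),
  (forall x, res_aug L (f1 x) = d1 x) /\
  (forall y, res_diff L 0 (f2 y) = - f1 (d2 y)).
Proof.
have [f1 f1E] := F1proj d1 (res_aug_surj L).
have nl : linear (fun y => - f1 (d2 y)).
  by move=> a x y; rewrite !linearP.
have [y|f2 f2E] := projective_lift (g := res_diff L 0) (f := mk_linear nl) F2proj.
  apply/res_exact0; rewrite -[LHS]/(res_aug L (- f1 (d2 y))) linearN f1E.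
  by apply/eqP; rewrite oppr_eq0; apply/eqP/d1_exact; exists y.
by exists f1, f2.
Qed.

Variables (f1 : {linear F1 -> res_obj L 0}) (f2 : {linear F2 -> res_obj L 1}).
Hypothesis f1E : forall x, res_aug L (f1 x) = d1 x.
Hypothesis f2E : forall y, res_diff L 0 (f2 y) = - f1 (d2 y).

Definition splice_obj (i : nat) : lmodType R :=
  match i with
  | 1 => (res_obj L 1 * F1)%type : lmodType R
  | 2 => (res_obj L 2 * F2)%type : lmodType R
  | i => res_obj L i
  end.

Lemma splice_diff0_subproof :
  linear (fun x : res_obj L 1 * F1 => res_diff L 0 x.1 + f1 x.2).
Proof. by move=> a x y; rewrite /= !linearP scalerDr addrACA. Qed.

Lemma splice_diff1_subproof :
  linear (fun x : res_obj L 2 * F2 => (res_diff L 1 x.1 + f2 x.2, d2 x.2)).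
Proof.
move=> a x y; congr pair; rewrite /= !linearP //.
by rewrite scalerDr addrACA.
Qed.

Lemma splice_diff2_subproof :
  linear (fun x : res_obj L 3 => (res_diff L 2 x, 0 : F2)).
Proof. by move=> a x y; congr pair; rewrite /= ?linearP ?scaler0 ?addr0. Qed.

(** Up to signs, the mapping cone of the chain map from [F2] -> [F1] to [L] that lifts [d1]. *)
Definition splice_diff (i : nat) : {linear splice_obj i.+1 -> splice_obj i} :=
  match i with
  | 0 => mk_linear splice_diff0_subproof
  | 1 => mk_linear splice_diff1_subproof
  | 2 => mk_linear splice_diff2_subproof
  | i.+3 => res_diff L i.+3
  end.

Lemma splice_aug_subproof : linear (fun x => e (res_aug L x)).
Proof. by move=> a x y; rewrite !linearP. Qed.

Lemma splice_projective i : projective (splice_obj i).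
Proof.
case: i => [|[|[|i]]]; rewrite /splice_obj; do ?exact: res_projective.
- by apply: projective_prod => //; exact: res_projective.
- by apply: projective_prod => //; exact: res_projective.
Qed.

Lemma res_diffK i y : res_diff L i (res_diff L i.+1 y) = 0.
Proof. by apply/res_exact; exists y. Qed.

Lemma splice_exact0 (x : splice_obj 0) :
  e (res_aug L x) = 0 <-> exists y, splice_diff 0 y = x.
Proof.
split=> [/e_exact[u uE]|[[y u] <-]].
  have [|y yE] := (res_exact0 (x - f1 u)).1.
    by rewrite linearB f1E uE subrr.
  by exists (y, u); rewrite -[LHS]/(res_diff L 0 y + f1 u) yE subrK.
rewrite -[X in res_aug L X]/(res_diff L 0 y + f1 u) linearD f1E.
have -> : res_aug L (res_diff L 0 y) = 0 by apply/res_exact0; exists y.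
by rewrite add0r; apply/e_exact; exists u.
Qed.

Lemma splice_exact i (x : splice_obj i.+1) :
  splice_diff i x = 0 <-> exists y, splice_diff i.+1 y = x.
Proof.
case: i x => [|[|[|i]]] x; last exact: (@res_exact _ _ L).
- case: x => x u.
  rewrite -[X in X <-> _]/(res_diff L 0 x + f1 u = 0).
  split=> [xu0|[[y v] [<- <-]]]; last first.
    by rewrite linearD res_diffK f2E add0r addNr.
  (* The [F1] part of a cycle is killed by [d1], hence is the image of some [v]; subtracting [f2 v]
     leaves a cycle of [L]. *)
  have /d1_exact[v vE] : d1 u = 0.
    rewrite -f1E -[RHS](linear0 (res_aug L)) -xu0 linearD.
    have -> : res_aug L (res_diff L 0 x) = 0 by apply/res_exact0; exists x.
    by rewrite add0r.
  have [|y yE] := (res_exact (x - f2 v)).1.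
    by rewrite linearB f2E opprK vE.
  by exists (y, v); congr pair => //=; rewrite yE subrK.
- case: x => x u; rewrite -[X in X <-> _]/((res_diff L 1 x + f2 u, d2 u) = 0).
  split=> [[xu0 u0]|[y [<- <-]]]; last first.
    by rewrite !linear0 res_diffK addr0.
  have uE : u = 0 by apply: d2_inj; rewrite u0 linear0.
  have [|y yE] := (res_exact x).1; first by move: xu0; rewrite uE linear0 addr0.
  by exists y; congr pair.
- rewrite -[X in X <-> _]/((res_diff L 2 x, 0 : F2) = 0).
  rewrite -[X in _ <-> X]/(exists y, res_diff L 3 y = x) -res_exact.
  by split=> [[]|->].
Qed.

Lemma splice_aug_surj : surjective (fun x => e (res_aug L x)).
Proof.
move=> w; have [v <-] := e_surj w; have [x <-] := res_aug_surj L v.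
by exists x.
Qed.

Definition splice_resolution : projective_resolution W :=
  @ProjectiveResolution R W splice_obj splice_diff
    (mk_linear splice_aug_subproof) splice_projective splice_aug_surj
    splice_exact0 splice_exact.

End Splice.

Section SpliceResult.
Variables (V W F1 F2 : lmodType R).
Variables (d2 : {linear F2 -> F1}) (d1 : {linear F1 -> V}).
Variable (e : {linear V -> W}).
Hypotheses (F1proj : projective F1) (F2proj : projective F2).
Hypothesis e_surj : surjective e.
Hypothesis e_exact : forall v, e v = 0 <-> exists x, d1 x = v.
Hypothesis d1_exact : forall x, d1 x = 0 <-> exists y, d2 y = x.
Hypothesis d2_inj : injective d2.

Lemma splice_FP n : finitely_generated F1 -> finitely_generated F2 ->
  module_FP n V -> module_FP n W.
Proof.
move=> F1fg F2fg [L Lfg].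
have [f1 [f2 [f1E f2E]]] := splice_lifts L F1proj F2proj d1_exact.
exists (splice_resolution F1proj F2proj e_surj e_exact d1_exact d2_inj f1E f2E).
move=> [|[|[|i]]] /Lfg Li //; exact: finitely_generated_prod.
Qed.

(** Above degree 2 the spliced resolution coincides with [L]. *)
Lemma splice_length n :
  (exists L : projective_resolution V, length_at_most L n) ->
  exists L : projective_resolution W, length_at_most L (maxn 2 n).
Proof.
case=> L Llen.
have [f1 [f2 [f1E f2E]]] := splice_lifts L F1proj F2proj d1_exact.
exists (splice_resolution F1proj F2proj e_surj e_exact d1_exact d2_inj f1E f2E).
by move=> [|[|[|i]]]; rewrite gtn_max // => /andP[_ /Llen].
Qed.

End SpliceResult.
End Projective.

(** * Modules over monoid rings *)

Lemma linear_mulrz (R : nzRingType) (U V : lmodType R) (f : {linear U -> V})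
  (z : int) x : f (x *~ z) = f x *~ z.
Proof. exact: raddfMz. Qed.

Section MonoidRingModules.
Variable M : monoidType.
Local Notation ZM := (monoid_ring M).

Lemma mr_ind (Q : ZM -> Prop) : Q 0 -> (forall a b, Q a -> Q b -> Q (a + b)) ->
  (forall x (z : int), Q (mr_of x *~ z)) -> forall a, Q a.
Proof.
move=> Q0 QD QU; apply: malg_ind => // x z.
rewrite -(mulr1z z : _ = z :> int) -[z in mkmalgU _ z]intz.
suff -> : mkmalgU x (z%:~R : int) = mr_of x *~ z by exact: QU.
exact: (raddfMz (mkmalgU x) z 1).
Qed.

Lemma mr_ofM (x y : M) : mr_of x * mr_of y = mr_of (x * y)%g.
Proof. exact: etrans (mr_mulUU _ _ _ _) _. Qed.

Lemma mr_of1 : mr_of 1%g = 1 :> ZM.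
Proof. by []. Qed.

(** Additive maps commute with integer multiples, and the elements of [M] span the ring over the
    integers. *)
Lemma equivariant_linear (U V : lmodType ZM) (f : U -> V) :
  {morph f : u v / u + v} ->
  (forall x u, f (mr_of x *: u) = mr_of x *: f u) -> linear f.
Proof.
move=> fD fM; pose f' := mk_additive fD.
move=> a u v; rewrite fD; congr (_ + _).
elim/mr_ind: a => [|a b IHa IHb|x z].
- by rewrite !scale0r; exact: (raddf0 f').
- by rewrite !scalerDl fD IHa IHb.
- by rewrite -!scalerMzl -fM; exact: (raddfMz f').
Qed.

Record monoid_action (V : zmodType) := MonoidAction {
  act_fun :> M -> V -> V;
  act_add : forall x, {morph act_fun x : u v / u + v};
  act_one : forall v, act_fun 1%g v = v;
  act_mul : forall x y v, act_fun (x * y)%g v = act_fun x (act_fun y v)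
}.

Section ActionModule.
Variables (V : zmodType) (act : monoid_action V).

Definition act_module : Type := let _ := act in V.
HB.instance Definition _ := GRing.Zmodule.on act_module.

Lemma act_scale_subproof (v : V) x :
  {morph (fun z : int => act x v *~ z) : y z / y + z}.
Proof. by move=> y z; rewrite mulrzDr. Qed.

Definition act_scale (a : ZM) (v : act_module) : act_module :=
  malg_ext (fun x => mk_additive (act_scale_subproof v x)) a.

Lemma act0 x : act x 0 = 0.
Proof. exact: (raddf0 (mk_additive (act_add act x))). Qed.

Lemma actMz x v z : act x (v *~ z) = act x v *~ z.
Proof. exact: (raddfMz (mk_additive (act_add act x))). Qed.

Let act_scaleU x (z : int) v : act_scale (mkmalgU x z) v = act x v *~ z.
Proof. exact: malg_extU. Qed.

Lemma act_scaleDl v : {morph act_scale^~ v : a b / a + b}.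
Proof. by move=> a b; rewrite /act_scale raddfD. Qed.

Lemma act_scale0 v : act_scale 0 v = 0.
Proof. by rewrite /act_scale raddf0. Qed.

Lemma act_scaleDr : right_distributive act_scale +%R.
Proof.
move=> a u v; rewrite /act_scale /malg_ext -big_split /=.
apply: eq_bigr => x _; rewrite /mk_additive /additive_of /=.
by rewrite act_add mulrzDl.
Qed.

Lemma act_scale1 : left_id 1 act_scale.
Proof. by move=> v; rewrite act_scaleU act_one. Qed.

Lemma act_scaleA a b v : act_scale a (act_scale b v) = act_scale (a * b) v.
Proof.
elim/malg_ind: a => [|a a' IH IH'|x z].
- by rewrite mul0r !act_scale0.
- by rewrite mulrDl !act_scaleDl IH IH'.
elim/malg_ind: b => [|b b' IH IH'|y t].
- rewrite mulr0 act_scale0 act_scaleU.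
  by rewrite act0 mul0rz.
- by rewrite mulrDr !act_scaleDl act_scaleDr IH IH'.
have -> : (mkmalgU x z : ZM) * (mkmalgU y t : ZM) = mkmalgU (x * y)%g (z * t).
  exact: mr_mulUU.
rewrite !act_scaleU act_mul.
by rewrite actMz -mulrzA mulrC.
Qed.

HB.instance Definition _ := GRing.Zmodule_isLmodule.Build ZM act_module
  act_scaleA act_scale1 act_scaleDr act_scaleDl.

Lemma act_moduleE x (v : act_module) : mr_of x *: v = act x v.
Proof. exact: act_scaleU. Qed.

End ActionModule.

Section MalgAction.
Variables (K : choiceType) (P : zmodType) (sigma : M -> K -> K).
Variable alpha : M -> K -> P -> P.
Hypothesis alphaD : forall x k, {morph alpha x k : p q / p + q}.
Hypothesis sigma1 : forall k, sigma 1%g k = k.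
Hypothesis sigmaM : forall x y k, sigma (x * y)%g k = sigma x (sigma y k).
Hypothesis alpha1 : forall k p, alpha 1%g k p = p.
Hypothesis alphaM : forall x y k p,
  alpha (x * y)%g k p = alpha x (sigma y k) (alpha y k p).

Let base_add x k : {morph (fun p => mkmalgU (sigma x k) (alpha x k p)) :
  p q / p + q}.
Proof. by move=> p q; rewrite alphaD monalgUD. Qed.

(** [sigma] moves the indices and [alpha] is a cocycle acting on the coefficients. Free modules use
    a trivial cocycle, induced modules the one given by coset representatives. *)
Definition malg_act_fun x := malg_ext (fun k => mk_additive (base_add x k)).

Lemma malg_act_funU x k p :
  malg_act_fun x (mkmalgU k p) = mkmalgU (sigma x k) (alpha x k p).
Proof. exact: malg_extU. Qed.

Lemma malg_act_add x : {morph malg_act_fun x : u v / u + v}.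
Proof. exact: raddfD. Qed.

Lemma malg_act_one v : malg_act_fun 1%g v = v.
Proof.
elim/malg_ind: v => [|u v IHu IHv|k p]; first exact: raddf0.
- by rewrite malg_act_add IHu IHv.
- by rewrite malg_act_funU sigma1 alpha1.
Qed.

Lemma malg_act_mul x y v :
  malg_act_fun (x * y)%g v = malg_act_fun x (malg_act_fun y v).
Proof.
elim/malg_ind: v => [|u v IHu IHv|k p]; first by rewrite /malg_act_fun !raddf0.
- by rewrite !malg_act_add IHu IHv.
- by rewrite !malg_act_funU sigmaM alphaM.
Qed.

Definition malg_action : monoid_action {malg P[K]} :=
  MonoidAction malg_act_add malg_act_one malg_act_mul.

Lemma malg_actionU x k p :
  mr_of x *: (mkmalgU k p : act_module malg_action) =
  mkmalgU (sigma x k) (alpha x k p).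
Proof. by rewrite act_moduleE; exact: malg_act_funU. Qed.

End MalgAction.

(* The free module on [B], with [gen m b] for the multiple of a basis element
   by [m]: only these properties are used, the construction being an obstacle to
   unification. *)
Record free_on (B : Type) (F : lmodType ZM) (gen : M -> B -> F) : Prop := FreeOn {
  free_ind : forall Q : F -> Prop, Q 0 ->
    (forall x y, Q x -> Q y -> Q (x + y)) ->
    (forall m b z, Q (gen m b *~ z)) -> forall x, Q x;
  free_actE : forall x m b, mr_of x *: gen m b = gen (x * m)%g b;
  free_additive : forall (V : zmodType) (u : M -> B -> V),
    exists f : {additive F -> V}, forall m b, f (gen m b) = u m b
}.

Lemma free_exists (B : choiceType) :
  exists (F : lmodType ZM) (gen : M -> B -> F), free_on gen.
Proof.
pose act : monoid_action {malg int[(M * B)%type]} :=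
  @malg_action (M * B)%type int (fun x k => ((x * k.1)%g, k.2))
    (fun _ _ p => p) (fun _ _ _ _ => erefl)
    ltac:(by case=> m b; rewrite /= mul1g)
    ltac:(by move=> x y [m b]; rewrite /= mulgA)
    (fun _ _ => erefl) (fun _ _ _ _ => erefl).
exists (act_module act), (fun m b => mkmalgU (m, b) (1 : int)); split.
- move=> Q Q0 QD QU; apply: malg_ind => // -[m b] z.
  rewrite -[z in mkmalgU _ z]intz.
  suff -> : mkmalgU (m, b) (z%:~R : int) = mkmalgU (m, b) (1 : int) *~ z.
    exact: QU.
  exact: (raddfMz (mkmalgU (m, b)) z 1).
- by move=> x m b; exact: malg_actionU.
- move=> V u.
  have uD k : {morph (fun z : int => u k.1 k.2 *~ z) : y z / y + z}.
    by move=> y z; rewrite mulrzDr.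
  exists (malg_ext (fun k => mk_additive (uD k))) => m b.
  exact: (malg_extU _ (m, b) 1).
Qed.

Section Free.
Variables (B : Type) (F : lmodType ZM) (gen : M -> B -> F).
Hypothesis Ffree : free_on gen.

Lemma free_linear (V : lmodType ZM) (u : B -> V) :
  exists f : {linear F -> V}, forall m b, f (gen m b) = mr_of m *: u b.
Proof.
have [f fE] := free_additive Ffree (fun m b => mr_of m *: u b).
have fl : linear f.
  apply: equivariant_linear => [|x]; first exact: raddfD.
  elim/(free_ind Ffree) => [|v w IHv IHw|m b z].
  - by rewrite scaler0 raddf0 scaler0.
  - by rewrite scalerDr !raddfD IHv IHw.
  - by rewrite -scalerMzr !raddfMz (free_actE Ffree) !fE;
       rewrite -mr_ofM -scalerA.
by exists (mk_linear fl) => m b; exact: fE.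
Qed.

Lemma free_projective : projective F.
Proof.
move=> U V g f gs; have [u uE] := boolp.choice (fun b => gs (f (gen 1%g b))).
have [h hE] := free_linear u; exists h.
elim/(free_ind Ffree) => [|v w IHv IHw|m b z]; first by rewrite !linear0.
  by rewrite !linearD IHv IHw.
rewrite !linear_mulrz hE linearZ uE; congr (_ *~ _).
by rewrite -linearZ (free_actE Ffree) mulg1.
Qed.

End Free.

Lemma free_finitely_generated (B : finType) (F : lmodType ZM)
  (gen : M -> B -> F) : free_on gen -> finitely_generated F.
Proof.
move=> Ffree; apply/finitely_generatedP.
exists [seq gen 1%g b | b <- enum B].
move=> Q Q0 QD QZ Qs; elim/(free_ind Ffree) => // m b z.
rewrite -(mulg1 m) -(free_actE Ffree) scalerMzl; apply/QZ/Qs/map_f.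
by rewrite mem_enum.
Qed.

End MonoidRingModules.

Section RingMap.
Variables (M N : monoidType) (f : M -> N).
Hypotheses (f1 : f 1%g = 1%g) (fM : {morph f : x y / (x * y)%g}).

Definition mr_map of f 1%g = 1%g & {morph f : x y / (x * y)%g} :
    monoid_ring M -> monoid_ring N :=
  malg_ext (fun m => (mkmalgU (f m) : {additive int -> {malg int[N]}})).

HB.instance Definition _ := GRing.isZmodMorphism.Build _ _ (mr_map f1 fM)
  (additive_of_subproof (raddfD (malg_ext
    (fun m => (mkmalgU (f m) : {additive int -> {malg int[N]}}))))).

Lemma mr_mapE x : mr_map f1 fM (mr_of x) = mr_of (f x).
Proof. exact: malg_extU. Qed.

Lemma mr_map0 : mr_map f1 fM 0 = 0.
Proof. exact: raddf0. Qed.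

Lemma mr_mapD : {morph mr_map f1 fM : a b / a + b}.
Proof. exact: raddfD. Qed.

Lemma mr_mapMz a z : mr_map f1 fM (a *~ z) = mr_map f1 fM a *~ z.
Proof. exact: raddfMz. Qed.

Lemma mr_map_is_monoid_morphism : monoid_morphism (mr_map f1 fM).
Proof.
split; first by rewrite -mr_of1 mr_mapE f1.
elim/mr_ind => [|a b IHa IHb|x z] c; first by rewrite mul0r mr_map0 mul0r.
  by rewrite mulrDl !mr_mapD IHa IHb mulrDl.
elim/mr_ind: c => [|a b IHa IHb|y t]; first by rewrite mulr0 mr_map0 mulr0.
  by rewrite mulrDr !mr_mapD IHa IHb mulrDr.
by rewrite mulrzAr mulrzAl !mr_mapMz mr_ofM !mr_mapE fM mulrzAr mulrzAl mr_ofM.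
Qed.

HB.instance Definition _ := GRing.isMonoidMorphism.Build _ _ (mr_map f1 fM)
  mr_map_is_monoid_morphism.
End RingMap.

Lemma mr_map_can (M N : monoidType) (f : M -> N) (g : N -> M)
    (f1 : f 1%g = 1%g) (fM : {morph f : x y / (x * y)%g})
    (g1 : g 1%g = 1%g) (gM : {morph g : x y / (x * y)%g}) :
  cancel f g -> cancel (mr_map f1 fM) (mr_map g1 gM).
Proof.
move=> fK; elim/mr_ind => [|a b IHa IHb|x z]; first by rewrite !mr_map0.
  by rewrite !mr_mapD IHa IHb.
by rewrite !mr_mapMz !mr_mapE fK.
Qed.

Section Units.
Variable M : monoidType.
Local Notation G := (units M).
Local Notation ZM := (monoid_ring M).
Local Notation ZG := (monoid_ring G).

Definition units_map : {rmorphism ZG -> ZM} :=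
  @mr_map G M (@unit_val M) erefl (fun _ _ => erefl).

Lemma units_mapE (g : G) : units_map (mr_of g) = mr_of (unit_val g).
Proof. exact: mr_mapE. Qed.

(** Each [m] is [lam m] times a reduced element, so [ZM] is free as a left [ZG]-module, and so is
    every free [ZM]-module. [P] is a retract of the free module on its elements. *)
Lemma projective_restr_units (lam : M -> G) (P : lmodType ZM) :
  (forall g m, lam (unit_val g * m)%g = (g * lam m)%g) ->
  projective P -> projective (restr units_map P).
Proof.
move=> lamM Pproj U V g f gs.
have [F [gen Ffree]] := free_exists M P.
have [pi piE] := free_linear Ffree id.
have pi_surj : surjective pi.
  by move=> p; exists (gen 1%g p); rewrite piE scale1r.
have [s sE] := Pproj _ _ pi (idfun : {linear P -> P}) pi_surj.
have [u uE] := boolp.choice (fun k : M * P => gs (f (mr_of k.1 *: k.2))).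
pose red m := (unit_val (lam m)^-1 * m)%g.
(* Lifts are used at reduced elements only and then translated by [lam m], which makes [h]
   equivariant under [G]. *)
have [h hE] := free_additive Ffree (fun m p => mr_of (lam m) *: u (red m, p)).
have hG x y : h (mr_of (unit_val x) *: y) = mr_of x *: h y.
  elim/(free_ind Ffree): y => [|v w IHv IHw|m p z].
  - by rewrite !(scaler0, raddf0).
  - by rewrite scalerDr !raddfD IHv IHw.
  - rewrite -scalerMzr !raddfMz (free_actE Ffree) !hE lamM -mr_ofM -scalerA.
    do 3![congr (_ *: _) || congr (_ *~ _)]; congr (u (_, _)).
    rewrite /red lamM invgM unit_valM -mulgA (mulgA (unit_val x^-1)%g).
    by rewrite unit_valVg mul1g.
have ghE y : g (h y) = f (pi y).
  elim/(free_ind Ffree): y => [|v w IHv IHw|m p z].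
  - by rewrite !raddf0.
  - by rewrite (raddfD h) !linearD IHv IHw.
  - rewrite (raddfMz h) !linear_mulrz hE piE linearZ uE -linearZ restrE.
    congr (f _ *~ _).
    by rewrite units_mapE scalerA mr_ofM mulgA unit_valgV mul1g.
have hsl : linear (fun p : restr units_map P => h (s p)).
  apply: equivariant_linear => [p q|x p]; first by rewrite !raddfD.
  by rewrite restrE units_mapE linearZ hG.
by exists (mk_linear hsl) => p; rewrite -[LHS]/(g (h (s p))) ghE sE.
Qed.

End Units.

(** * Induction from the group of units *)

Section Induction.
Variable M : monoidType.
Local Notation G := (units M).
Local Notation ZM := (monoid_ring M).
Local Notation ZG := (monoid_ring G).

Variable rho : M -> G.
Hypothesis rhoM : forall m g, rho (m * unit_val g)%g = (rho m * g)%g.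

(* [j m p] stands for the tensor [m (x) p]; the elements [t] with [rho t = 1]
   form a basis of [ZM] as a right [ZG]-module. *)
Record induced_from (P : lmodType ZG) (I : lmodType ZM) (j : M -> P -> I) :
    Prop := InducedFrom {
  ind_sum : forall x, exists (s : seq M) (c : M -> P),
    [/\ uniq s, forall t, t \in s -> rho t = 1%g & x = \sum_(t <- s) j t (c t)];
  ind_actE : forall x m p, mr_of x *: j m p = j (x * m)%g p;
  ind_add : forall m, {morph j m : p q / p + q};
  ind_units : forall m g p, j (m * unit_val g)%g p = j m (mr_of g *: p);
  ind_ext : forall (V : zmodType) (u : M -> P -> V),
    (forall m, {morph u m : p q / p + q}) ->
    (forall m g p, u (m * unit_val g)%g p = u m (mr_of g *: p)) ->
    exists f : {additive I -> V}, forall m p, f (j m p) = u m p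
}.

Definition coset_rep (m : M) : M := (m * unit_val (rho m)^-1)%g.

Lemma rho_coset_rep m : rho (coset_rep m) = 1%g.
Proof. by rewrite rhoM mulgV. Qed.

Lemma coset_repK m : (coset_rep m * unit_val (rho m))%g = m.
Proof. by rewrite -mulgA unit_valVg mulg1. Qed.

Lemma coset_split x m : (x * coset_rep m * unit_val (rho m) = x * m)%g.
Proof. by rewrite -mulgA coset_repK. Qed.

Lemma coset_rep_id m : rho m = 1%g -> coset_rep m = m.
Proof. by rewrite /coset_rep => ->; rewrite invg1 mulg1. Qed.

Lemma coset_rep_mulg m g : coset_rep (m * unit_val g)%g = coset_rep m.
Proof.
rewrite /coset_rep rhoM invgM unit_valM -mulgA; congr (_ * _)%g.
by rewrite mulgA unit_valgV mul1g.
Qed.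

(** The direct sum of copies of [P] indexed by the elements [t] with [rho t] trivial: [x] moves the
    copy at [t] to that of the representative of x t and acts on it by the unit [rho (x * t)]. *)
Lemma induced_exists (P : lmodType ZG) :
  exists (I : lmodType ZM) (j : M -> P -> I), induced_from j.
Proof.
pose T := {m : M | rho m == 1%g}.
pose tau m : T := exist _ (coset_rep m) (introT eqP (rho_coset_rep m)).
have tauE (t : T) : tau (val t) = t.
  apply: val_inj; exact: coset_rep_id (eqP (valP t)).
have tauG m g : tau (m * unit_val g)%g = tau m.
  by apply: val_inj; rewrite /= coset_rep_mulg.
have tauM x m : tau (x * val (tau m))%g = tau (x * m)%g.
  by rewrite -[in RHS](coset_split x m) tauG.
have rhoT x m : rho (x * m)%g = (rho (x * val (tau m)) * rho m)%g.
  by rewrite -[in LHS](coset_split x m) rhoM.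
pose sigma x (t : T) := tau (x * val t)%g.
pose alpha x (t : T) (p : P) := mr_of (rho (x * val t)%g) *: p.
have alphaD x t : {morph alpha x t : p q / p + q}.
  by move=> p q; rewrite /alpha scalerDr.
have sigma1 t : sigma 1%g t = t by rewrite /sigma mul1g tauE.
have sigmaM x y t : sigma (x * y)%g t = sigma x (sigma y t).
  by rewrite /sigma tauM mulgA.
have alpha1 t p : alpha 1%g t p = p.
  by rewrite /alpha mul1g (eqP (valP t)) scale1r.
have alphaM x y t p : alpha (x * y)%g t p = alpha x (sigma y t) (alpha y t p).
  by rewrite /alpha scalerA mr_ofM /sigma -rhoT mulgA.
pose act := malg_action alphaD sigma1 sigmaM alpha1 alphaM.
exists (act_module act), (fun m p => mkmalgU (tau m) (mr_of (rho m) *: p)); split.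
- move=> x; exists [seq val t | t <- msupp x].
  exists (fun m => mcoeff (tau m) x); split.
  + by rewrite map_inj_uniq ?fset_uniq //; exact: val_inj.
  + by move=> m /mapP[t _ ->]; apply/eqP/(valP t).
  + rewrite big_map [LHS]monalgE; apply: eq_bigr => t _.
    by rewrite tauE (eqP (valP t)) scale1r.
- move=> x m p; rewrite malg_actionU /alpha scalerA mr_ofM -rhoT.
  by rewrite /sigma tauM.
- by move=> m p q; rewrite scalerDr monalgUD.
- by move=> m g p; rewrite tauG rhoM -mr_ofM scalerA.
- move=> V u uD uG.
  exists (malg_ext (fun t : T => mk_additive (uD (val t)))) => m p.
  apply: etrans (malg_extU _ _ _) _.
  rewrite -[RHS](congr1 (u^~ p) (coset_repK m)).
  exact: esym (uG _ _ _).
Qed.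

Section Induced.
Variables (P : lmodType ZG) (I : lmodType ZM) (j : M -> P -> I).
Hypothesis Iind : induced_from j.

Lemma ind0 m : j m 0 = 0.
Proof. by exact: (raddf0 (mk_additive (ind_add Iind m))). Qed.

Lemma ind_ind (Q : I -> Prop) : Q 0 -> (forall x y, Q x -> Q y -> Q (x + y)) ->
  (forall m p, Q (j m p)) -> forall x, Q x.
Proof.
move=> Q0 QD Qj x; have [s [c [_ _ ->]]] := ind_sum Iind x.
by elim/big_ind: _.
Qed.

Lemma ind_linear (V : lmodType ZM) (u : P -> V) :
  {morph u : p q / p + q} ->
  (forall g p, u (mr_of g *: p) = mr_of (unit_val g) *: u p) ->
  exists f : {linear I -> V}, forall m p, f (j m p) = mr_of m *: u p.
Proof.
move=> uD uG.
have [||f fE] := ind_ext Iind (u := fun m p => mr_of m *: u p).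
- by move=> m p q; rewrite uD scalerDr.
- by move=> m g p; rewrite uG scalerA mr_ofM.
have fl : linear f.
  apply: equivariant_linear => [|x]; first exact: raddfD.
  elim/ind_ind => [|v w IHv IHw|m p].
  - by rewrite scaler0 raddf0 scaler0.
  - by rewrite scalerDr !raddfD IHv IHw.
  - by rewrite (ind_actE Iind) !fE scalerA mr_ofM.
by exists (mk_linear fl) => m p; exact: fE.
Qed.

(** The projection to the copy at [t]; it shows that the summands in [ind_sum] are independent. *)
Lemma ind_coordinate (t : M) : rho t = 1%g ->
  exists f : {additive I -> P}, forall m p, rho m = 1%g ->
    f (j m p) = if m == t then p else 0.
Proof.
move=> t1.
have [||f fE] := ind_ext Iind
  (u := fun m p => if coset_rep m == t then mr_of (rho m) *: p else 0).
- by move=> m p q; case: ifP => _; rewrite ?scalerDr ?addr0.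
- by move=> m g p; rewrite coset_rep_mulg rhoM scalerA mr_ofM.
exists f => m p m1; rewrite fE coset_rep_id // m1 scale1r.
by [].
Qed.

Lemma ind_sum_eq0 (s : seq M) (c : M -> P) :
  uniq s -> (forall t, t \in s -> rho t = 1%g) ->
  \sum_(t <- s) j t (c t) = 0 -> forall t, t \in s -> c t = 0.
Proof.
move=> us s1 sum0 t ts; have [f fE] := ind_coordinate (s1 t ts).
move: (congr1 f sum0); rewrite raddf_sum raddf0 (bigD1_seq t) //= fE ?s1 // eqxx.
rewrite big1_seq ?addr0 // => m /andP[mt ms].
by rewrite fE ?s1 // (negPf mt).
Qed.

(** By the adjunction of induction and restriction, a lifting problem for [I] is one for [P]. *)
Lemma ind_projective : projective P -> projective I.
Proof.
move=> Pproj U V g f gs.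
have fl : linear (fun p => f (j 1%g p) : restr (units_map M) V).
  apply: equivariant_linear => [p q|x p]; first by rewrite (ind_add Iind) linearD.
  rewrite restrE units_mapE -linearZ (ind_actE Iind) -(ind_units Iind).
  by rewrite mul1g mulg1.
have [h hE] := Pproj _ _ (restr_linear (units_map M) g) (mk_linear fl) gs.
have [||H HE] := @ind_linear U h.
- exact: raddfD.
- by move=> x p; rewrite linearZ /=; rewrite restrE units_mapE.
exists H; elim/ind_ind => [|x y IHx IHy|m p]; first by rewrite !linear0.
  by rewrite !linearD IHx IHy.
rewrite HE linearZ.
have -> : g (h p) = f (j 1%g p) by exact: hE.
by rewrite -linearZ (ind_actE Iind) mulg1.
Qed.

Lemma ind_finitely_generated : finitely_generated P -> finitely_generated I.
Proof.
move=> /finitely_generatedP[s sP]; apply/finitely_generatedP.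
exists [seq j 1%g p | p <- s] => Q Q0 QD QZ Qs.
elim/ind_ind => // m p.
rewrite -[m]mulg1 -(ind_actE Iind); apply: (QZ).
elim/sP: p => [|u v Qu Qv|a u Qu|u us].
- by rewrite ind0.
- by rewrite (ind_add Iind); apply: (QD).
- have jz z v : j 1%g (v *~ z) = j 1%g v *~ z.
    exact: (raddfMz (mk_additive (ind_add Iind 1%g))).
  elim/mr_ind: a => [|a b Qa Qb|g z].
  + by rewrite scale0r ind0.
  + by rewrite scalerDl (ind_add Iind); apply: (QD).
  + rewrite -scalerMzl jz -(ind_units Iind) mul1g -[unit_val g]mulg1.
    by rewrite -(ind_actE Iind) scalerMzl; apply: (QZ).
- by apply/Qs/map_f.
Qed.

End Induced.

Section InducedMap.
Variables (P Q : lmodType ZG) (I J : lmodType ZM).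
Variables (j : M -> P -> I) (k : M -> Q -> J).
Hypotheses (Iind : induced_from j) (Jind : induced_from k).
Variable d : {linear P -> Q}.

Lemma ind_map : exists D : {linear I -> J}, forall m p, D (j m p) = k m (d p).
Proof.
have [||D DE] := ind_linear Iind (u := fun p => k 1%g (d p)).
- by move=> p q; rewrite linearD (ind_add Jind).
- move=> g p; rewrite linearZ (ind_actE Jind) -(ind_units Jind).
  by rewrite mul1g mulg1.
by exists D => m p; rewrite DE (ind_actE Jind) mulg1.
Qed.
End InducedMap.

(** Induction is a direct sum over coset representatives, so exactness can be checked one coordinate
    at a time. *)
Lemma ind_exact (P Q S : lmodType ZG) (I J K : lmodType ZM)
    (j : M -> P -> I) (k : M -> Q -> J) (l : M -> S -> K)
    (d : {linear P -> Q}) (d' : {linear Q -> S})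
    (D : {linear I -> J}) (D' : {linear J -> K}) :
  induced_from j -> induced_from k -> induced_from l ->
  (forall m p, D (j m p) = k m (d p)) ->
  (forall m p, D' (k m p) = l m (d' p)) ->
  (forall x, d' x = 0 <-> exists y, d y = x) ->
  forall x, D' x = 0 <-> exists y, D y = x.
Proof.
move=> Iind Jind Kind DE D'E exact x; split=> [x0|[y <-]]; last first.
  elim/(ind_ind Iind): y => [|u v IHu IHv|m p]; rewrite ?linear0 //.
    by rewrite !linearD IHu IHv addr0.
  rewrite DE D'E; have -> : d' (d p) = 0 by apply/exact; exists p.
  by rewrite (ind0 Kind).
have [s [c [us s1 xE]]] := ind_sum Jind x; rewrite xE in x0 *.
move: x0; rewrite linear_sum; under eq_bigr do rewrite D'E.
move=> /(ind_sum_eq0 Kind us s1) c0.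
have [b bE] := boolp.choice (fun t : {t | t \in s} =>
  (exact _).1 (c0 (val t) (valP t))).
(* Preimages are chosen on [s] only; 0 is a dummy value elsewhere. *)
pose b' t := if insub t is Some t' then b t' else 0.
exists (\sum_(t <- s) j t (b' t)); rewrite linear_sum; apply: eq_big_seq => t ts.
by rewrite DE /b' insubT bE.
Qed.

End Induction.

Section InducedResolution.
Variables (M : monoidType) (rho : M -> units M).
Local Notation G := (units M).
Local Notation ZM := (monoid_ring M).
Local Notation ZG := (monoid_ring G).
Hypothesis rhoM : forall m g, rho (m * unit_val g)%g = (rho m * g)%g.

Definition induced (P : lmodType ZG) : lmodType ZM :=
  projT1 (cid (induced_exists rhoM P)).

Definition tensor (P : lmodType ZG) : M -> P -> induced P :=
  projT1 (cid (projT2 (cid (induced_exists rhoM P)))).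

Lemma tensorP (P : lmodType ZG) : induced_from rho (@tensor P).
Proof. exact: (projT2 (cid (projT2 (cid (induced_exists rhoM P))))). Qed.

Definition induced_map (P Q : lmodType ZG) (d : {linear P -> Q}) :
    {linear induced P -> induced Q} :=
  projT1 (cid (ind_map (tensorP P) (tensorP Q) d)).

Lemma induced_mapE (P Q : lmodType ZG) (d : {linear P -> Q}) m p :
  induced_map d (tensor m p) = tensor m (d p).
Proof. by rewrite /induced_map; case: cid. Qed.

Lemma induced_map_surj (P Q : lmodType ZG) (d : {linear P -> Q}) :
  surjective d -> surjective (induced_map d).
Proof.
move=> ds; elim/(ind_ind (tensorP Q)) => [|x y [u <-] [v <-]|m q].
- by exists 0; rewrite linear0.
- by exists (u + v); rewrite linearD.
- by have [p <-] := ds q; exists (tensor m p); rewrite induced_mapE.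
Qed.

Definition induced_resolution (V : lmodType ZG) (P : projective_resolution V) :
  projective_resolution (induced V) :=
  @ProjectiveResolution ZM (induced V) (fun i => induced (res_obj P i))
    (fun i => induced_map (res_diff P i)) (induced_map (res_aug P))
    (fun i => ind_projective (tensorP _) (@res_projective _ _ P i))
    (induced_map_surj (res_aug_surj P))
    (ind_exact rhoM (tensorP _) (tensorP _) (tensorP _)
       (induced_mapE _) (induced_mapE _) (@res_exact0 _ _ P))
    (fun i => ind_exact rhoM (tensorP _) (tensorP _) (tensorP _)
       (induced_mapE _) (induced_mapE _) (@res_exact _ _ P i)).

Lemma induced_FP n (V : lmodType ZG) : module_FP n V -> module_FP n (induced V).
Proof.
case=> P Pfg; exists (induced_resolution P) => i /Pfg.
exact: ind_finitely_generated (tensorP _).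
Qed.

Lemma induced_length n (V : lmodType ZG) (P : projective_resolution V) :
  length_at_most P n -> length_at_most (induced_resolution P) n.
Proof.
move=> Pn i ni; elim/(ind_ind (tensorP (res_obj P i))) => // [x y -> ->|m p].
  by rewrite addr0.
by rewrite (Pn i ni p) (ind0 (tensorP _)).
Qed.

End InducedResolution.

(** * Restriction of resolutions to the group of units *)

Section RestrictedResolution.
Variable M : monoidType.
Local Notation G := (units M).

Lemma trivial_restr_linear :
  linear (id : restr (units_map M) (trivial_left M) -> trivial_left G).
Proof.
apply: equivariant_linear => // g z.
by rewrite restrE units_mapE !trivial_leftE.
Qed.

Variable lam : M -> G.
Hypothesis lamM : forall g m, lam (unit_val g * m)%g = (g * lam m)%g.
Variable P : projective_resolution (trivial_left M : lmodType (monoid_ring M)).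

Lemma restr_aug_subproof :
  linear (res_aug P : restr (units_map M) (res_obj P 0) -> trivial_left G).
Proof.
move=> a u v; rewrite -(trivial_restr_linear a) !restrE.
exact: (linearP (res_aug P)).
Qed.

Definition restr_resolution :
    projective_resolution (trivial_left G : lmodType (monoid_ring G)) :=
  @ProjectiveResolution (monoid_ring G) (trivial_left G)
    (fun i => restr (units_map M) (res_obj P i))
    (fun i => restr_linear (units_map M) (res_diff P i))
    (mk_linear restr_aug_subproof)
    (fun i => projective_restr_units lamM (@res_projective _ _ P i))
    (res_aug_surj P) (@res_exact0 _ _ P) (@res_exact _ _ P).

Lemma restr_length n : length_at_most P n -> length_at_most restr_resolution n.
Proof. by []. Qed.
End RestrictedResolution.

(** * The complex of cosets of the group of units *)

Section CosetComplex.
Variables (M : monoidType) (A : finType) (iota : A -> M).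
Local Notation G := (units M).
Local Notation ZM := (monoid_ring M).
Local Notation ZG := (monoid_ring G).
Variables (H : G -> Prop) (R : seq (rule M A)).
Hypothesis Rmin : minimal_presentation iota H R.
Hypothesis iota_gen : forall P : M -> Prop,
  P 1%g -> (forall m a, P m -> P (m * iota a)%g) -> forall m, P m.
Variable nf : M -> word M A * G.
Hypothesis nf_normal : forall m, normal_state H R (nf m).
Hypothesis nfK : forall m, state_ev iota (nf m) = m.
Hypothesis nfE : forall x, normal_state H R x -> nf (state_ev iota x) = x.

Let rho := last_unit nf.
Let rhoM m g : rho (m * unit_val g)%g = (rho m * g)%g.
Proof. exact: (last_unit_mulg Rmin iota_gen nf_normal nfK nfE m g). Qed.

(** This is Z[M/G], with [coset m] the class of [m]. *)
Let V := induced rhoM (trivial_left G).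
Let coset (m : M) : V := tensor rhoM (P := trivial_left G) m (1 : int).

Let cosetP : induced_from rho (tensor rhoM (P := trivial_left G)) :=
  tensorP rhoM (trivial_left G).

Lemma coset_mulg m g : coset (m * unit_val g)%g = coset m.
Proof. by rewrite /coset (ind_units cosetP) trivial_leftE. Qed.

Lemma coset_ind (Q : V -> Prop) : Q 0 -> (forall x y, Q x -> Q y -> Q (x + y)) ->
  (forall m (z : int), Q (coset m *~ z)) -> forall x, Q x.
Proof.
move=> Q0 QD Qz; elim/(ind_ind cosetP) => // m z.
suff -> : tensor rhoM m z = coset m *~ (z : int) by [].
rewrite -[z in LHS](intz (z : int)).
exact: (raddfMz (mk_additive (ind_add cosetP m)) (z : int) (1 : int)).
Qed.

Lemma coset_act x m : mr_of x *: coset m = coset (x * m)%g.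
Proof. by rewrite /coset (ind_actE cosetP). Qed.

Lemma coset_augmentation :
  exists e : {linear V -> trivial_left M}, forall m, e (coset m) = (1 : int).
Proof.
have [|g p|e eE] := ind_linear cosetP (V := trivial_left M)
  (u := id : trivial_left G -> trivial_left M) => //.
  by rewrite !trivial_leftE.
by exists e => m; rewrite eE trivial_leftE.
Qed.

Let J := seq_sub R.

(** * Paths, faces and the contraction *)

Section Complex.
Variables (F1 : lmodType ZM) (edge : M -> A -> F1).
Hypothesis F1free : free_on edge.
Variables (F2 : lmodType ZM) (face : M -> J -> F2).
Hypothesis F2free : free_on face.

(** The path from [m] that spells [w] in the Cayley graph. Units contribute no edge, since the
    vertices are cosets of [G]. *)
Fixpoint chain (m : M) (w : word M A) : F1 :=
  if w is (g, a) :: w' then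
    edge (m * unit_val g)%g a + chain (m * unit_val g * iota a)%g w'
  else 0.

Lemma chain_cat m u v :
  chain m (u ++ v) = chain m u + chain (m * ev iota u)%g v.
Proof.
elim: u m => [|[g a] u IH] m /=; first by rewrite add0r mulg1.
by rewrite IH addrA !mulgA.
Qed.

Lemma chain_act x m w : mr_of x *: chain m w = chain (x * m)%g w.
Proof.
elim: w m => [|[g a] w IH] m /=; first by rewrite scaler0.
by rewrite scalerDr IH (free_actE F1free) !mulgA.
Qed.

Definition rule_word (r : rule M A) : word M A := (1%g, r.1.1) :: r.1.2.

Variables (e : {linear V -> trivial_left M}) (d1 : {linear F1 -> V})
  (d2 : {linear F2 -> F1}).
Hypothesis eE : forall m, e (coset m) = (1 : int).
Hypothesis d1E : forall m a,
  d1 (edge m a) = coset (m * iota a)%g - coset m.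
Hypothesis d2E : forall m (r : J), d2 (face m r) = chain m (rule_word (val r)).

Lemma aug_surj : surjective e.
Proof.
move=> z; exists (coset 1%g *~ (z : int)); rewrite linear_mulrz eE.
exact: intz.
Qed.

Lemma d1_chain m w : d1 (chain m w) = coset (m * ev iota w)%g - coset m.
Proof.
elim: w m => [|[g a] w IH] m /=; first by rewrite linear0 mulg1 subrr.
by rewrite linearD IH d1E coset_mulg !mulgA addrC subrKA.
Qed.

Lemma aug_exact v : e v = 0 <-> exists x, d1 x = v.
Proof.
split=> [v0|[x <-]]; last first.
  elim/(free_ind F1free): x => [|x y IHx IHy|m a z]; rewrite ?linear0 //.
    by rewrite !linearD IHx IHy addr0.
  by rewrite !linear_mulrz d1E linearB !eE subrr mul0rz.
(* The graph is connected: a path spelling [m] joins the coset of 1 to that of [m]. *)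
have [x xE] : exists x, d1 x = v - coset 1%g *~ (e v : int).
  elim/coset_ind: v {v0} => [|u v [x xE] [y yE]|m z].
  - by exists 0; rewrite !linear0 addr0.
  - exists (x + y); rewrite !linearD xE yE addrACA -opprD.
    by rewrite -(mulrzDr (coset 1%g)).
  - have [x xE] : exists x, d1 x = coset m - coset 1%g.
      elim/iota_gen: m => [|m a [x xE]]; first by exists 0; rewrite linear0 subrr.
      exists (edge m a + x); rewrite linearD xE d1E.
      by rewrite addrA subrK.
    exists (x *~ z); rewrite (linear_mulrz d1) (linear_mulrz e) xE eE mulrzBl.
    by congr (_ - _); congr (_ *~ _); exact: esym (intz z).
by exists x; rewrite xE v0 mulr0z subr0.
Qed.

Let Rvalid r : r \in R -> rule_ev iota r = unit_val r.2.
Proof. by case: Rmin => -[_ Rv _ _] _; exact: Rv. Qed.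

(** The path of a rule ends at its starting point times a unit, hence in the same coset. *)
Lemma d1_d2 y : d1 (d2 y) = 0.
Proof.
elim/(free_ind F2free): y => [|x y IHx IHy|m r z]; rewrite ?linear0 //.
  by rewrite !linearD IHx IHy addr0.
rewrite (linear_mulrz d2) (linear_mulrz d1) d2E d1_chain /= mul1g.
by rewrite -/(rule_ev iota _) Rvalid ?(valP r) // coset_mulg subrr mul0rz.
Qed.

Lemma chain_unit m g a w :
  chain m ((g, a) :: w) = chain (m * unit_val g)%g ((1%g, a) :: w).
Proof. by rewrite /= mulg1. Qed.

Lemma chain_rcons m w q :
  chain m (rcons w q) = chain m w + edge (m * ev iota w * unit_val q.1)%g q.2.
Proof. by rewrite -cats1 chain_cat; case: q => g a /=; rewrite addr0. Qed.

Let push m a := rcons (nf m).1 ((nf m).2, a).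

(** The face is placed where the completed left-hand side begins. A failure of [insub] cannot come
    from [trigger], which only finds rules in [R]. *)
Definition face_of (q : option (word M A * G * rule M A)) : F2 :=
  if q is Some (u, k, r) then
    if insub r is Some r' then face (ev iota u * unit_val k)%g r' else 0
  else 0.

Lemma face_ofE u k (r : J) :
  face_of (Some (u, k, val r)) = face (ev iota u * unit_val k)%g r.
Proof. by rewrite /= valK. Qed.

(** Along a rule read from [m] the normal form grows without reduction until its last letter. The
    head of [rule_word], with coefficient 1, takes over the last unit of [m], whence [behead]. *)
Lemma push_prefix m r w q l : r \in R -> rule_word r = w ++ q :: l ->
  push (m * ev iota w * unit_val q.1)%g q.2 =
  (nf m).1 ++ ((nf m).2, r.1.1) :: behead (rcons w q).
Proof.
move=> rR; case: w => [|p w] [].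
  by move=> <- _; rewrite /push /= !mulg1 cats1.
move=> <- tE; have mE := nfK m; rewrite /push; case E: (nf m) mE => [s g] /= mE.
rewrite (_ : m * _ * _ = state_ev iota (s ++ (g, r.1.1) :: w, q.1))%g; last first.
  by rewrite /state_ev /= ev_cat /= -mE /state_ev /= mul1g !mulgA.
rewrite nfE /=; first by rewrite rcons_cat -surjective_pairing.
apply: (irreducible_normal Rmin iota_gen); apply: (irreducible_push Rmin _ rR tE).
by have := nf_irreducible nf_normal (m := m); rewrite E.
Qed.

Section Contraction.
Variables (s : {additive V -> F1}) (h : {additive F1 -> F2}).
Hypothesis sE : forall m, s (coset m) = chain 1%g (nf m).1.
Hypothesis hE : forall m a, h (edge m a) = face_of (trigger R (push m a)).

Lemma h_chain_prefix m r w l : r \in R -> rule_word r = w ++ l -> l <> [::] ->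
  h (chain m w) = 0.
Proof.
move=> rR; elim/last_ind: w l => [|w q IH] l rE l0; first exact: raddf0.
rewrite cat_rcons in rE; rewrite chain_rcons raddfD (IH _ rE) // hE add0r.
rewrite (push_prefix _ rR rE) (trigger_irreducible Rmin) //.
case: l rE l0 => // q' l' rE _.
have irrm := nf_irreducible nf_normal (m := m).
apply: (@irreducible_push _ _ _ _ _ Rmin _ _ _ _ q' l' irrm rR).
by case: w rE {IH} => [|p w] [] _ ->; rewrite //= cat_rcons.
Qed.

(** All edges of the boundary but the last vanish under [h] by [h_chain_prefix], and the last one
    completes the rule of the face. *)
Lemma h_d2 y : h (d2 y) = y.
Proof.
elim/(free_ind F2free): y => [|x y IHx IHy|m r z].
- by rewrite linear0 raddf0.
- by rewrite linearD raddfD IHx IHy.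
rewrite linear_mulrz raddfMz d2E; congr (_ *~ _).
have rR : val r \in R by exact: valP.
case/lastP E: (rule_word (val r)) => [//|w q].
have rE : rule_word (val r) = w ++ [:: q] by rewrite E cats1.
rewrite chain_rcons raddfD (h_chain_prefix m rR rE) // add0r hE.
have [_ trig] := triggerP Rmin
  ((nf m).1 ++ ((nf m).2, (val r).1.1) :: (val r).1.2) (nf m, val r).
rewrite (push_prefix _ rR rE) -E /= trig //.
by rewrite (surjective_pairing (nf m)) face_ofE; congr face; exact: nfK.
Qed.

(** If an edge completes no rule, it extends the normal-form path to its source into the one to its
    target. If it does, the normal-form path to the target lacks the completed left-hand side, whose
    path is the boundary of the face. *)
Lemma homotopy x : x = s (d1 x) + d2 (h x).
Proof.
elim/(free_ind F1free): x => [|x y IHx IHy|m a z].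
- by rewrite !(linear0, raddf0) addr0.
- by rewrite {1}IHx {1}IHy (raddfD h) !linearD (raddfD s) addrACA.
rewrite (raddfMz h) !linear_mulrz (raddfMz s) -mulrzDl; congr (_ *~ _).
rewrite d1E raddfB !sE hE (nf_mula Rmin nf_normal nfK nfE) /state_mula -/(push m a).
have pushE : chain 1%g (push m a) = chain 1%g (nf m).1 + edge m a.
  by rewrite chain_rcons mul1g /= -{5}(nfK m).
rewrite /reduce; case E: trigger => [[[u k] r]|] /=; last first.
  by rewrite pushE linear0 addr0 addrC addKr.
have [/= rR uE] := (triggerP Rmin _ _).1 E.
rewrite insubT d2E.
have <- : chain (ev iota u) ((k, r.1.1) :: r.1.2) =
  chain (ev iota u * unit_val k)%g (rule_word r) by exact: chain_unit.
apply: (addrI (chain 1%g (nf m).1)); rewrite -pushE uE chain_cat mul1g.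
by rewrite [RHS]addrA [X in _ = X + _]addrC subrK.
Qed.

Lemma d1_exact x : d1 x = 0 <-> exists y, d2 y = x.
Proof.
split=> [x0|[y <-]]; last exact: d1_d2.
by exists (h x); rewrite [RHS]homotopy x0 raddf0 add0r.
Qed.
End Contraction.
End Complex.

Lemma coset_complex : exists (F1 F2 : lmodType ZM) (d2 : {linear F2 -> F1})
    (d1 : {linear F1 -> V}) (e : {linear V -> trivial_left M}),
  [/\ (projective F1 /\ projective F2) /\
      (finitely_generated F1 /\ finitely_generated F2),
      surjective e,
      forall v, e v = 0 <-> exists x, d1 x = v,
      forall x, d1 x = 0 <-> exists y, d2 y = x
    & injective d2].
Proof.
have [F1 [edge F1free]] := free_exists M A.
have [F2 [face F2free]] := free_exists M (seq_sub R).
have [e eE] := coset_augmentation.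
have [d1 d1E0] := free_linear F1free (fun a => coset (iota a) - coset 1%g).
have [d2 d2E0] := free_linear F2free
  (fun r : J => chain edge 1%g (rule_word (val r))).
have d1E m a : d1 (edge m a) = coset (m * iota a)%g - coset m.
  by rewrite d1E0 scalerBr !coset_act mulg1.
have d2E m (r : J) : d2 (face m r) = chain edge m (rule_word (val r)).
  by rewrite d2E0 (chain_act F1free) mulg1.
(* The path to [m] depends on its coset only, as a unit on the right changes just the trailing unit
   of the normal form. *)
have [||s sE0] := ind_ext cosetP
  (u := fun m (z : trivial_left G) => chain edge 1%g (nf m).1 *~ (z : int)).
- by move=> m y z; rewrite -mulrzDr.
- move=> m g z; rewrite trivial_leftE.
  by rewrite (nf_mulg Rmin iota_gen nf_normal nfK nfE).
have sE m : s (coset m) = chain edge 1%g (nf m).1 by rewrite /coset sE0.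
have [h hE] := free_additive F1free
  (fun m a => face_of face (trigger R (rcons (nf m).1 ((nf m).2, a)))).
exists F1, F2, d2, d1, e; split.
- split; split.
  + exact: (free_projective F1free).
  + exact: (free_projective F2free).
  + exact: (free_finitely_generated F1free).
  + exact: (free_finitely_generated (B := seq_sub R) F2free).
- exact: (aug_surj eE).
- exact: (aug_exact F1free eE d1E).
- exact: (d1_exact F1free F2free d1E d2E sE hE).
- by apply: (can_inj (g := h)); exact: (h_d2 F2free d2E hE).
Qed.

Lemma left_FP_units n : left_FP n G -> left_FP n M.
Proof.
have [F1 [F2 [d2 [d1 [e [[[P1 P2] [fg1 fg2]] es eex d1ex d2i]]]]]] := coset_complex.
by move/(induced_FP rhoM)/(splice_FP P1 P2 es eex d1ex d2i fg1 fg2).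
Qed.

Lemma left_cd_le_units : enat_le (left_cd M) (enat_max 2%N (left_cd G)).
Proof.
have [F1 [F2 [d2 [d1 [e [[[P1 P2] [fg1 fg2]] es eex d1ex d2i]]]]]] := coset_complex.
apply: enat_least_max => n [P Pn]; apply: (splice_length P1 P2 es eex d1ex d2i).
by exists (induced_resolution rhoM P); exact: induced_length.
Qed.

Lemma units_cd_le_left : enat_le (left_cd G) (left_cd M).
Proof.
apply: enat_least_mono => n [P Pn].
exists (restr_resolution (first_unit_mulg Rmin iota_gen nf_normal nfK nfE) P).
exact: restr_length.
Qed.

End CosetComplex.

(** * Passage to the opposite monoid *)

Lemma special_left (M : monoidType) : finitely_presented_special M ->
  [/\ forall n, left_FP n (units M) -> left_FP n M,
      enat_le (left_cd M) (enat_max 2%N (left_cd (units M)))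
    & enat_le (left_cd (units M)) (left_cd M)].
Proof.
case=> A [ws [f [f_bij f1 fM]]].
have [iota [iota_gen [H [R HR]]]] := special_presentation f_bij f1 fM.
have [H' [R' Rmin]] := exists_minimal HR.
have [nf [nf_normal nfK nfE]] := exists_normal_form Rmin iota_gen.
split.
- by move=> n; exact: (left_FP_units Rmin iota_gen nf_normal nfK nfE).
- exact: (left_cd_le_units Rmin iota_gen nf_normal nfK nfE).
- exact: (units_cd_le_left Rmin iota_gen nf_normal nfK nfE).
Qed.

Section Transfer.
Variables (R S : nzRingType) (phi : {rmorphism R -> S}) (psi : {rmorphism S -> R}).
Hypotheses (phiK : cancel phi psi) (psiK : cancel psi phi).
Variables (V : lmodType S) (W : lmodType R) (theta : V -> W) (eta : W -> V).
Hypotheses (thetaK : cancel theta eta) (etaK : cancel eta theta).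
Hypothesis theta_linear : linear (theta : restr phi V -> W).

Lemma transfer_inverse_linear : linear (eta : restr psi W -> V).
Proof.
move=> a u v; apply: (can_inj thetaK); rewrite etaK restrE.
have := theta_linear (psi a) (eta u) (eta v); rewrite restrE psiK => ->.
by rewrite !etaK.
Qed.

Lemma transfer_dimension : projective_dimension W = projective_dimension V.
Proof.
congr enat_least; apply/funext => n; apply/propext; split=> -[P Pn].
- exists (transfer_resolution psiK phiK transfer_inverse_linear
            (Bijective etaK thetaK) P).
  exact: transfer_length.
- exists (transfer_resolution phiK psiK theta_linear
            (Bijective thetaK etaK) P).
  exact: transfer_length.
Qed.

Lemma transfer_FP_can n : module_FP n V -> module_FP n W.
Proof. exact: (transfer_FP phiK psiK theta_linear (Bijective thetaK etaK)). Qed.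
End Transfer.

Section Opposite.
Variable M : monoidType.

Definition opposite : Type := M.
HB.instance Definition _ := Choice.on opposite.

Definition op_mul (x y : opposite) : opposite := ((y : M) * (x : M))%g.

Lemma op_mulA : associative op_mul.
Proof. by move=> x y z; rewrite /op_mul mulgA. Qed.
Lemma op_mul1 : left_id (1%g : M) op_mul.
Proof. by move=> x; rewrite /op_mul mulg1. Qed.
Lemma op_1mul : right_id (1%g : M) op_mul.
Proof. by move=> x; rewrite /op_mul mul1g. Qed.

HB.instance Definition _ := isMonoid.Build opposite op_mulA op_mul1 op_1mul.

End Opposite.

Section OppositeRing.
Variable M : monoidType.
Local Notation Mop := (opposite M).

Definition to_op_ring : (monoid_ring M)^c -> monoid_ring Mop := fun f => f.
Definition of_op_ring : monoid_ring Mop -> (monoid_ring M)^c := fun f => f.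

(** Both rings have the same underlying group; exchanging the two finite sums shows that the
    identity is an isomorphism from the converse ring. *)
Lemma op_mulE (f g : monoid_ring Mop) :
  f * g = (g : monoid_ring M) * (f : monoid_ring M).
Proof.
rewrite -[LHS]/(mr_mul f g) -[RHS]/(mr_mul (g : monoid_ring M) f) /mr_mul.
rewrite exchange_big; apply: eq_bigr => x _; apply: eq_bigr => y _.
by rewrite mulrC.
Qed.

HB.instance Definition _ := GRing.isZmodMorphism.Build _ _ to_op_ring
  (fun _ _ => erefl).
Lemma to_op_ring_monoid_morphism : monoid_morphism to_op_ring.
Proof. by split=> // f g; rewrite /to_op_ring op_mulE. Qed.
HB.instance Definition _ := GRing.isMonoidMorphism.Build _ _ to_op_ring
  to_op_ring_monoid_morphism.

HB.instance Definition _ := GRing.isZmodMorphism.Build _ _ of_op_ring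
  (fun _ _ => erefl).
Lemma of_op_ring_monoid_morphism : monoid_morphism of_op_ring.
Proof. by split=> // f g; rewrite /of_op_ring op_mulE. Qed.
HB.instance Definition _ := GRing.isMonoidMorphism.Build _ _ of_op_ring
  of_op_ring_monoid_morphism.

Let theta : trivial_left Mop -> trivial_right M := id.

Lemma theta_linear :
  linear (theta : restr to_op_ring (trivial_left Mop) -> trivial_right M).
Proof. by []. Qed.

Lemma right_FP_opposite n : left_FP n Mop -> right_FP n M.
Proof.
exact: (@transfer_FP_can _ _ to_op_ring of_op_ring (fun _ => erefl)
  (fun _ => erefl) _ _ theta id (fun _ => erefl) (fun _ => erefl) theta_linear).
Qed.

Lemma right_cd_opposite : right_cd M = left_cd Mop.
Proof.
exact: (@transfer_dimension _ _ to_op_ring of_op_ring (fun _ => erefl)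
  (fun _ => erefl) _ _ theta id (fun _ => erefl) (fun _ => erefl) theta_linear).
Qed.

(* An element and its inverse are exchanged, so that [units M] and
   [units (opposite M)] are isomorphic rather than anti-isomorphic. *)
Definition to_op_units (u : units M) : units Mop :=
  @Units Mop ((unit_pair u).2, (unit_pair u).1) (valP u).
Definition of_op_units (u : units Mop) : units M :=
  @Units M ((unit_pair u).2, (unit_pair u).1) (valP u).

Lemma to_op_unitsK : cancel to_op_units of_op_units.
Proof. by case=> -[x y] xy; apply: val_inj. Qed.
Lemma of_op_unitsK : cancel of_op_units to_op_units.
Proof. by case=> -[x y] xy; apply: val_inj. Qed.

Lemma to_op_units1 : to_op_units 1%g = 1%g.
Proof. exact: val_inj. Qed.
Lemma of_op_units1 : of_op_units 1%g = 1%g.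
Proof. exact: val_inj. Qed.
Lemma to_op_unitsM : {morph to_op_units : x y / (x * y)%g}.
Proof. by move=> u v; apply: val_inj. Qed.
Lemma of_op_unitsM : {morph of_op_units : x y / (x * y)%g}.
Proof. by move=> u v; apply: val_inj. Qed.

Let phi : {rmorphism monoid_ring (units Mop) -> monoid_ring (units M)} :=
  mr_map of_op_units1 of_op_unitsM.
Let psi : {rmorphism monoid_ring (units M) -> monoid_ring (units Mop)} :=
  mr_map to_op_units1 to_op_unitsM.

Let phiK : cancel phi psi := mr_map_can _ _ _ _ of_op_unitsK.
Let psiK : cancel psi phi := mr_map_can _ _ _ _ to_op_unitsK.

Let theta_units : trivial_left (units M) -> trivial_left (units Mop) := id.

Lemma theta_units_linear :
  linear (theta_units :
    restr phi (trivial_left (units M)) -> trivial_left (units Mop)).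
Proof.
apply: equivariant_linear => // x u.
rewrite restrE; have -> : phi (mr_of x) = mr_of (of_op_units x).
  exact: mr_mapE.
by rewrite !trivial_leftE.
Qed.

Lemma units_FP_opposite n : left_FP n (units M) -> left_FP n (units Mop).
Proof.
exact: (@transfer_FP_can _ _ phi psi phiK psiK
  _ _ theta_units id (fun _ => erefl) (fun _ => erefl) theta_units_linear).
Qed.

Lemma units_cd_opposite : left_cd (units Mop) = left_cd (units M).
Proof.
exact: (@transfer_dimension _ _ phi psi phiK psiK
  _ _ theta_units id (fun _ => erefl) (fun _ => erefl) theta_units_linear).
Qed.

End OppositeRing.

(** * Word reversal *)

Section OppositePresentation.
Variable A : finType.
Implicit Types ws : seq (seq A).
Let relations ws := [seq (w, [::] : seq A) | w <- ws].

(** The reversed relators are a variable [ws'] with an equation, so that reversing twice lands in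
    the type of [ws] without a cast. *)
Lemma pres_congr_rev ws ws' u v : [seq rev w | w <- ws] = ws' ->
  pres_congr (relations ws) u v -> pres_congr (relations ws') (rev u) (rev v).
Proof.
move=> <-; elim=> {u v} [u v l r /mapP[w wws [-> ->]]|u|u v _|v u w _ uv _ vw].
- rewrite (rev_cat u v : rev (u ++ [::] ++ v) = rev v ++ [::] ++ rev u).
  rewrite !rev_cat -catA; apply: pres_congr_step.
  by apply/mapP; exists (rev w) => //; apply: map_f.
- exact: pres_congr_refl.
- exact: pres_congr_sym.
- exact: pres_congr_trans uv vw.
Qed.

Definition pres_rev ws ws' (x : presented_monoid (relations ws)) :
    presented_monoid (relations ws') :=
  (\pi_(presented_monoid (relations ws')) (rev (generic_quotient.repr x)))%qT.

Lemma pres_revE ws ws' u : [seq rev w | w <- ws] = ws' ->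
  pres_rev ws' (\pi_(presented_monoid (relations ws)) u)%qT =
  (\pi_(presented_monoid (relations ws')) (rev u))%qT.
Proof.
move=> wsE; apply/eqP/pi_presP/(pres_congr_rev wsE)/pi_presP.
by rewrite reprK.
Qed.

Lemma pres_revK ws ws' : [seq rev w | w <- ws] = ws' ->
  [seq rev w | w <- ws'] = ws -> cancel (@pres_rev ws ws') (@pres_rev ws' ws).
Proof.
move=> wsE wsE'; elim/quotW => u.
by rewrite (pres_revE _ wsE) (pres_revE _ wsE') revK.
Qed.

End OppositePresentation.

Lemma special_opposite (M : monoidType) :
  finitely_presented_special M -> finitely_presented_special (opposite M).
Proof.
case=> A [ws [f [f_bij f1 fM]]]; pose ws' := [seq rev w | w <- ws].
have wsE : [seq rev w | w <- ws] = ws' by [].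
have wsE' : [seq rev w | w <- ws'] = ws.
  by rewrite -map_comp map_id_in // => w; rewrite /= revK.
exists A, ws', (fun x => pres_rev ws' (f x)); split.
- by apply: bij_comp f_bij; exists (@pres_rev _ ws' ws); apply: pres_revK.
- by rewrite f1; exact: pres_revE.
- move=> x y; rewrite -[(x * y)%g]/((y : M) * (x : M))%g fM.
  elim/quotW: (f x) => u; elim/quotW: (f y) => v.
  rewrite -[(_ * _)%g in LHS]/(pres_mul _ _) -[(_ * _)%g in RHS]/(pres_mul _ _).
  by rewrite pres_mulE !(pres_revE _ wsE) pres_mulE rev_cat.
Qed.

Theorem theorem3p16 (M : monoidType) (hM : finitely_presented_special M) :
  (forall n : enat, enat_le 1%N n -> group_FP n (units M) ->
     left_FP n M /\ right_FP n M) /\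
  (enat_le (cd (units M)) (left_cd M) /\
   enat_le (left_cd M) (enat_max 2%N (cd (units M))) /\
   enat_le (cd (units M)) (right_cd M) /\
   enat_le (right_cd M) (enat_max 2%N (cd (units M)))).
Proof.
have [FPl upl lowl] := special_left hM.
(* The right-hand claims are the left-hand ones for the opposite monoid, whose group of units is
   isomorphic to that of [M]. *)
have [FPr upr lowr] := special_left (special_opposite hM).
rewrite /cd right_cd_opposite -(units_cd_opposite M); do !split=> //.
all: rewrite ?units_cd_opposite // in upl lowl *.
- exact: FPl.
- by apply/right_FP_opposite/FPr/units_FP_opposite.
Qed.
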